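(* Let $n,r$ be positive integers. If $(a,b)$ is the $\mathcal{I}_n$-decomposition of the colored derangement polynomial $d_{n,r}(z)$, then both $a$ and $b$ are real-rooted. In particular, the local $h$-polynomial of the $r$-th edgewise subdivision of the barycentric subdivision of $2^{[n]}$ is real-rooted.
   Context: An $r$-colored permutation is $(\pi,c)$ with $\pi\in\mathfrak{S}_n$, $c\in\{0,\ldots,r-1\}^n$; $i$ is an excedance if $\pi_i>i$ or ($\pi_i=i$ and $c_i>0$); derangements have no fixed point of color $0$; $d_{n,r}(z)=\sum z^{\mathrm{exc}(\sigma)}$ over $r$-colored derangements of length $n$. The $\mathcal{I}_n$-decomposition of a polynomial $p$ of degree at most $n$ is the unique pair $(a,b)$ with $p=a+zb$, $a(z)=z^na(1/z)$, $b(z)=z^{n-1}b(1/z)$, $\deg a\le n$, $\deg b\le n-1$. Real-rooted means all zeros real or identically zero. The barycentric subdivision of $2^{[n]}$ has vertices the nonempty subsets of $[n]$ and faces the chains; its $r$-th edgewise subdivision applies to each face (vertices ordered by inclusion) the $r$-th edgewise subdivision of a simplex with ordered vertices $v_1<\dots<v_k$: vertices $x\in\mathbb{Z}^k_{\ge0}$ with $\sum x_i=r$, faces the sets $F$ with $\varphi(x)-\varphi(y)$ or $\varphi(y)-\varphi(x)$ in $\{0,1\}^k$ for all $x,y\in F$, where $\varphi(x)=(x_1,x_1+x_2,\ldots,x_1+\cdots+x_k)$. For a $(d-1)$-dimensional complex $\Omega$, $h(\Omega;z)=\sum_{i=0}^d f_{i-1}z^i(1-z)^{d-i}$; for a subdivision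 $\Omega$ of $2^V$, $|V|=n$, the local $h$-polynomial is $\sum_{F\subseteq V}(-1)^{n-|F|}h(\Omega_F;z)$, $\Omega_F$ the restriction to $F$ and $h(\Omega_\emptyset;z)=1$. *)

(* Defs.v *)
From mathcomp Require Import all_boot all_order all_algebra all_fingroup.
From mathcomp Require Import algC.
Import GRing.Theory Num.Theory.
Local Open Scope ring_scope.

(* Polynomials are taken with coefficients in algC (algebraic complex numbers);
   all polynomials here have integer coefficients, so all their complex zeros
   lie in algC. *)

Definition colored_exc (n r : nat) (s : {perm 'I_n}) (c : {ffun 'I_n -> 'I_r}) : nat :=
  #|[set i : 'I_n | (i < s i)%N || ((s i == i) && (0 < c i)%N)]|.

Definition colored_derangement (n r : nat) (s : {perm 'I_n}) (c : {ffun 'I_n -> 'I_r}) : bool :=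
  [forall i : 'I_n, (s i == i) ==> (0 < c i)%N].

Definition colored_derangement_poly (n r : nat) : {poly algC} :=
  \sum_(s : {perm 'I_n})
    \sum_(c : {ffun 'I_n -> 'I_r} | colored_derangement n r s c)
       'X^(colored_exc n r s c).

(* p = a + z b, deg a <= n, deg b <= n-1, a(z) = z^n a(1/z), b(z) = z^(n-1) b(1/z).
   For deg a <= n, z^n a(1/z) is the polynomial with coefficient a_{n-i} at z^i. *)
Definition In_decomposition (n : nat) (p a b : {poly algC}) : Prop :=
  [/\ p = a + 'X * b,
      (size a <= n.+1)%N,
      (size b <= n)%N,
      a = \poly_(i < n.+1) a`_(n - i)
    & b = \poly_(i < n) b`_(n.-1 - i)].

Definition real_rooted (p : {poly algC}) : Prop :=
  p = 0 \/ (forall x : algC, root p x -> x \is Num.real).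

(* A vertex lies in the edgewise subdivision of a face (chain) of the barycentric
   subdivision: it is a function x from nonempty subsets of [n] to N, with sum r,
   whose support is a chain (the coordinates of the point w.r.t. that chain). *)
Definition esd_vertex_pred (n r : nat) (f : {ffun {set 'I_n} -> 'I_r.+1}) : bool :=
  [&& f set0 == ord0,
      (\sum_(S : {set 'I_n}) (f S : nat) == r)%N
    & [forall S : {set 'I_n}, forall T : {set 'I_n},
         ((f S != ord0) && (f T != ord0)) ==> ((S \subset T) || (T \subset S))]].

Definition esd_vertex (n r : nat) :=
  {f : {ffun {set 'I_n} -> 'I_r.+1} | esd_vertex_pred n r f}.

Definition esd_supp (n r : nat) (x : esd_vertex n r) (S : {set 'I_n}) : bool :=
  val x S != ord0.

(* phi(x) evaluated at the chain element S : x_1 + ... + x_S *)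
Definition esd_phi (n r : nat) (x : esd_vertex n r) (S : {set 'I_n}) : nat :=
  (\sum_(T : {set 'I_n} | T \subset S) (val x T : nat))%N.

Arguments esd_supp {n r} x S.
Arguments esd_phi {n r} x S.

Definition diff01 (a b : nat) : bool := (a == b) || (a == b.+1).

(* A face: a set G of vertices all lying in the subdivision of one chain C
   (the union of their supports is a chain), such that for all x, y in G,
   phi(x) - phi(y) or phi(y) - phi(x) lies in {0,1}^C. *)
Definition esd_face (n r : nat) (G : {set esd_vertex n r}) : bool :=
  [forall x in G, forall y in G,
     [forall S : {set 'I_n}, forall T : {set 'I_n},
        (esd_supp x S && esd_supp y T) ==> ((S \subset T) || (T \subset S))]
     && ([forall S : {set 'I_n},
            [exists z in G, esd_supp z S] ==> diff01 (esd_phi x S) (esd_phi y S)]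
         || [forall S : {set 'I_n},
            [exists z in G, esd_supp z S] ==> diff01 (esd_phi y S) (esd_phi x S)])].

Arguments esd_face {n r} G.

Definition esd_face_in (n r : nat) (F : {set 'I_n}) (G : {set esd_vertex n r}) : bool :=
  esd_face G && [forall x in G, forall S : {set 'I_n}, esd_supp x S ==> (S \subset F)].

Arguments esd_face_in {n r} F G.

Definition esd_fcount (n r : nat) (F : {set 'I_n}) (i : nat) : nat :=
  #|[set G : {set esd_vertex n r} | esd_face_in F G & #|G| == i]|.

(* h(Omega_F; z), Omega_F has dimension |F| - 1 *)
Definition esd_h (n r : nat) (F : {set 'I_n}) : {poly algC} :=
  \sum_(i < #|F|.+1)
     (esd_fcount n r F i)%:R *: ('X^i * (1 - 'X) ^+ (#|F| - i)).

Definition esd_local_h (n r : nat) : {poly algC} :=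
  \sum_(F : {set 'I_n}) (-1) ^+ (n - #|F|) * esd_h n r F.

(* Main.v *)
(** For z < 0 put P_n(y) = sum over s in S_n of z^exc(s) y^fix(s). These
    polynomials in y satisfy P_n' = n P_(n-1) and P_n(z) = z P_n(1) for n > 0.
    Since z < 0, integrating and imposing the second relation never creates sign
    changes, so every P_n changes sign at most once on [z, 1]; when P_n(1) = 0
    it therefore has constant sign on (z, 1), governed by P_(n-1)(1).
    With q = (r-1)/r the derangement polynomial is d(z) = r^n P_n(z q), its
    reversal is e(z) = r^n P_n(q), and (1-z) b = e - d, (1-z) a = d - z e.
    Mean value arguments in q then give the signs of b at the zeros of the
    Eulerian polynomial A_(n-1), and of a / z at those of A_(n-2); they alternate,
    which locates all the zeros. The same sign information shows that the
    Eulerian polynomials A_n(z) = P_n(1) themselves interlace.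

    For the local h-polynomial, a face with m vertices of the subdivision is
    encoded by the sum w : [n] -> {0, ..., r m} of its vertices, written as
    integer points; its vertices are recovered as floor((w + c) / m), c < m.
    Counting these w by iterated differences of t^n gives (1-z) h in terms of
    P_n, and the alternating sum over subsets is a shift of y by -1/r, whence
    (1-z) times the local h-polynomial is again d - z e. *)

Require Import Defs.
From mathcomp Require Import all_boot all_order all_algebra all_fingroup.
From mathcomp Require Import algC polyrcf.
From mathcomp Require Import ring lra zify.
Import Order.TTheory GRing.Theory Num.Theory.
Local Open Scope ring_scope.

Set Implicit Arguments.
Unset Strict Implicit.
Unset Printing Implicit Defensive.

(** * Appell sequences with twisted boundary values *)

Lemma deriv_neg_decr (R : rcfType) (p : {poly R}) (a b : R) :
  (forall y, a < y < b -> p^`().[y] < 0) ->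
  forall x y, a <= x -> x < y -> y <= b -> p.[y] < p.[x].
Proof.
move=> hp x y ax xy yb; have [c cxy pxy] := poly_mvt p xy.
move: cxy; rewrite in_itv /= => /andP[xc cy].
rewrite -subr_lt0 pxy nmulr_rlt0 ?subr_gt0 // hp //.
by rewrite (le_lt_trans ax xc) (lt_le_trans cy yb).
Qed.

Lemma deriv_pos_incr (R : rcfType) (p : {poly R}) (a b : R) :
  (forall y, a < y < b -> 0 < p^`().[y]) ->
  forall x y, a <= x -> x < y -> y <= b -> p.[x] < p.[y].
Proof.
move=> hp x y ax xy yb; rewrite -ltrN2 -!hornerN.
apply: (@deriv_neg_decr _ _ a b) => // t /hp.
by rewrite derivN hornerN oppr_lt0.
Qed.

Section TwistedAppell.

Variables (R : rcfType) (P : nat -> {poly R}) (z l u : R).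
Hypothesis P0 : P 0%N = 1.
Hypothesis derivP : forall m, (P m.+1)^`() = m.+1%:R *: P m.
Hypothesis z_lt0 : z < 0.
Hypothesis lt_lu : l < u.
Hypothesis twist : forall m, (P m.+1).[l] = z * (P m.+1).[u].

(** Induction on [m]: [s *: P m.+1] falls up to the old [t] and rises after it, and the twist with
    [z < 0] gives its end values weakly opposite signs. So only one of the two monotone pieces can
    carry a sign change. *)
Lemma twisted_one_sign_change m :
  exists s t, [/\ s != 0, l <= t <= u,
    forall y, l < y < t -> s * (P m).[y] < 0
    & forall y, t < y < u -> 0 < s * (P m).[y]].
Proof.
elim: m => [|m [s [t [s0 /andP[lt tu] neg pos]]]].
  exists 1, l; rewrite oner_eq0 lexx (ltW lt_lu) P0; split=> // y.
    by case/andP=> a b; rewrite ltNge (ltW b) in a.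
  by rewrite hornerC mulr1.
pose q := s *: P m.+1.
have qE y : q.[y] = s * (P m.+1).[y] by rewrite hornerZ.
have dqE y : q^`().[y] = m.+1%:R * (s * (P m).[y]).
  by rewrite derivZ derivP !hornerZ mulrCA.
have decr : forall x y, l <= x -> x < y -> y <= t -> q.[y] < q.[x].
  by apply: deriv_neg_decr => y /neg h; rewrite dqE pmulr_rlt0 ?ltr0n.
have incr : forall x y, t <= x -> x < y -> y <= u -> q.[x] < q.[y].
  by apply: deriv_pos_incr => y /pos h; rewrite dqE pmulr_rgt0 ?ltr0n.
have tw : q.[l] = z * q.[u] by rewrite !qE twist mulrCA.
have decrW x y : l <= x -> x <= y -> y <= t -> q.[y] <= q.[x].
  by move=> lx; rewrite le_eqVlt => /predU1P[->//|xy] yt; apply/ltW/decr.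
have incrW x y : t <= x -> x <= y -> y <= u -> q.[x] <= q.[y].
  by move=> lx; rewrite le_eqVlt => /predU1P[->//|xy] yt; apply/ltW/incr.
(* If [0 <= q.[u]], the new change point lies in [[t, u]]; otherwise it lies in [[l, t]] and [s]
   becomes [- s]. *)
have [qu|qu] := leP 0 q.[u].
  have ql : q.[l] <= 0 by rewrite tw nmulr_rle0.
  have qt : q.[t] <= 0 by apply: le_trans ql; apply: decrW.
  have [|t' t'in /rootP qt'] := @polyrcf.poly_ivt _ q t u tu.
    by rewrite mulr_le0_ge0.
  move: t'in; rewrite in_itv /= => /andP[tt' t'u].
  exists s, t'; rewrite s0 (le_trans lt tt') t'u; split=> // y.
    rewrite -qE => /andP[ly yt']; have [yt|ty] := leP y t.
      by apply: lt_le_trans ql; apply: decr.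
    by rewrite -qt'; apply: incr => //; apply: ltW.
  by rewrite -qE => /andP[t'y yu]; rewrite -qt'; apply: incr => //; apply: ltW.
have ql : 0 < q.[l] by rewrite tw nmulr_rgt0.
have qt : q.[t] < 0 by apply: le_lt_trans qu; apply: incrW.
have [|t' t'in /rootP qt'] := @polyrcf.poly_ivt _ q l t lt.
  by rewrite mulr_ge0_le0 // ltW.
move: t'in; rewrite in_itv /= => /andP[lt' t't].
exists (- s), t'; rewrite oppr_eq0 s0 lt' (le_trans t't tu); split=> // y.
  rewrite mulNr -qE oppr_lt0 => /andP[ly yt'].
  by rewrite -qt'; apply: decr => //; apply: ltW.
rewrite mulNr -qE oppr_gt0 => /andP[t'y yu]; have [yt|ty] := leP y t.
  by rewrite -qt'; apply: decr.
by apply: lt_trans qu; apply: incr => //; apply: ltW.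
Qed.

(** Vanishing at [u] forces vanishing at [l] by the twist. Between these zeros [s *: P m.+1] falls
    and then rises, so it is negative; so is [s *: P m] just after [l], hence at [l]. *)
Lemma twisted_const_sign m y : (P m.+1).[u] = 0 -> (P m).[l] != 0 ->
  l < y < u -> 0 < (P m).[l] * (P m.+1).[y].
Proof.
move=> Pu Pl lyu.
have [s [t [s0 /andP[lt tu] neg pos]]] := twisted_one_sign_change m.
pose q := s *: P m.+1.
have qE x : q.[x] = s * (P m.+1).[x] by rewrite hornerZ.
have dqE x : q^`().[x] = m.+1%:R * (s * (P m).[x]).
  by rewrite derivZ derivP !hornerZ mulrCA.
have decr : forall x y, l <= x -> x < y -> y <= t -> q.[y] < q.[x].
  by apply: deriv_neg_decr => x /neg h; rewrite dqE pmulr_rlt0 ?ltr0n.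
have incr : forall x y, t <= x -> x < y -> y <= u -> q.[x] < q.[y].
  by apply: deriv_pos_incr => x /pos h; rewrite dqE pmulr_rgt0 ?ltr0n.
have qu : q.[u] = 0 by rewrite qE Pu mulr0.
have ql : q.[l] = 0 by rewrite qE twist Pu !mulr0.
(* If [t] were an endpoint, [q] would be strictly monotone between two zeros. *)
have {}lt : l < t.
  rewrite lt_neqAle lt andbT; apply: contraTneq lt_lu => e.
  have [lu|//] := boolP (l < u); have := incr l u; rewrite -e qu ql ltxx.
  by move/(_ (lexx _) lu (lexx _)).
have {}tu : t < u.
  rewrite lt_neqAle tu andbT; apply: contraTneq lt_lu => e.
  have [lu|//] := boolP (l < u); have := decr l u; rewrite e qu ql ltxx.
  by move/(_ (lexx _) lu (lexx _)).
have qy : s * (P m.+1).[y] < 0.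
  case/andP: lyu => ly yu; rewrite -qE; have [yt|ty] := leP y t.
    by rewrite -ql decr.
  by rewrite -qu incr // ltW.
have sPl : s * (P m).[l] < 0.
  rewrite lt_neqAle mulf_eq0 negb_or s0 Pl /= leNgt; apply/negP => h.
  pose c := (l + t) / 2%:R.
  have lc : l < c by rewrite /c; lra.
  have ct : c < t by rewrite /c; lra.
  have hc : s * (P m).[c] < 0 by apply: neg; rewrite lc ct.
  have [||x] := @poly_ivtoo _ (s *: P m) l c; first exact: ltW.
    by rewrite !hornerZ pmulr_rlt0.
  rewrite in_itv /= => /andP[lx xc] /rootP; rewrite hornerZ => e.
  by have := neg x; rewrite lx (lt_trans xc ct) e ltxx => /(_ isT).
have : 0 < (s * (P m).[l]) * (s * (P m.+1).[y]) by rewrite nmulr_rgt0.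
by rewrite mulrACA pmulr_rgt0 // -expr2 exprn_even_gt0.
Qed.

End TwistedAppell.

(** * Sign rules on the interval from z to 1 *)

Section TwistedAppellUnit.

Variables (R : rcfType) (P : nat -> {poly R}) (z : R).
Hypothesis P0 : P 0%N = 1.
Hypothesis derivP : forall m, (P m.+1)^`() = m.+1%:R *: P m.
Hypothesis z_lt0 : z < 0.
Hypothesis twist : forall m, (P m.+1).[z] = z * (P m.+1).[1].
Variable m : nat.
Hypothesis P2_eq0 : (P m.+2).[1] = 0.
Hypothesis P1_neq0 : (P m.+1).[1] != 0.

Let z_lt1 : z < 1. Proof. by apply: lt_trans z_lt0 _. Qed.

Lemma twisted_opposite_sign y : z < y < 1 -> (P m.+1).[1] * (P m.+2).[y] < 0.
Proof.
move=> zy; have := @twisted_const_sign R P z z 1 P0 derivP z_lt0 z_lt1 twist.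
move=> /(_ m.+1 y P2_eq0); rewrite twist mulf_eq0 negb_or lt_eqF //= => /(_ P1_neq0 zy).
by rewrite -mulrA nmulr_rgt0.
Qed.

Lemma twisted_diff_sign x y : z <= x -> x < y -> y <= 1 ->
  (P m.+1).[1] * ((P m.+3).[y] - (P m.+3).[x]) < 0.
Proof.
move=> zx xy y1; have [c] := poly_mvt (P m.+3) xy.
rewrite in_itv /= => /andP[xc cy] ->; rewrite derivP hornerZ.
have := @twisted_opposite_sign c.
rewrite (le_lt_trans zx xc) (lt_le_trans cy y1) => /(_ isT) h.
by rewrite mulrA nmulr_rlt0 ?subr_gt0 // mulrCA pmulr_rlt0 ?ltr0n.
Qed.

(** By the twist, the increment of [P m.+3] over [[z, 1]] is [(1 - z) * (P m.+3).[1]]. For Eulerian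
    polynomials this relates the signs of the two neighbours at a zero of the middle one. *)
Lemma twisted_step_sign : (P m.+1).[1] * (P m.+3).[1] < 0.
Proof.
have := @twisted_diff_sign z 1 (lexx _) z_lt1 (lexx _); rewrite twist.
rewrite -[X in X - _]mul1r -mulrBl mulrCA pmulr_rlt0 // subr_gt0 //.
Qed.

(** The polynomial [G] vanishes at [1] by the twist, and its derivative is a multiple of the
    increment of [P m.+3] between [z * x] and [x], whose sign is known. *)
Lemma twisted_combination_sign q : 0 <= q < 1 ->
  0 < (P m.+1).[1] * ((P m.+4).[z * q] - z * (P m.+4).[q]).
Proof.
case/andP=> q0 q1.
pose G := P m.+4 \Po (z *: 'X) - z *: P m.+4.
have GE x : G.[x] = (P m.+4).[z * x] - z * (P m.+4).[x].
  by rewrite !hornerE horner_comp !hornerE.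
have G1 : G.[1] = 0 by rewrite GE mulr1 twist subrr.
have dG x : G^`().[x] = m.+4%:R * (z * ((P m.+3).[z * x] - (P m.+3).[x])).
  rewrite derivB deriv_comp derivZ derivX !derivZ !derivP.
  rewrite !hornerE horner_comp !hornerE /=.
  by rewrite !hornerE; ring.
rewrite -GE; have -> : G.[q] = - (G.[1] - G.[q]) by rewrite G1 sub0r opprK.
have [c] := poly_mvt G q1; rewrite in_itv /= => /andP[qc c1] ->.
rewrite dG mulrN oppr_gt0 !mulrA nmulr_rlt0 ?subr_gt0 //.
have c0 : 0 < c by apply: le_lt_trans qc.
have zzc : z <= z * c.
  rewrite -subr_ge0; have -> : z * c - z = (- z) * (1 - c) by ring.
  by apply: mulr_ge0; [rewrite oppr_ge0; apply: ltW | rewrite subr_ge0; apply: ltW].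
have zc : z * c < c by rewrite (lt_trans _ c0) // nmulr_rlt0.
have h := @twisted_diff_sign (z * c) c zzc zc (ltW c1).
rewrite -[X in X < 0]opprK oppr_lt0.
have -> : - ((P m.+1).[1] * m.+4%:R * z * ((P m.+3).[z * c] - (P m.+3).[c]))
  = m.+4%:R * (z * ((P m.+1).[1] * ((P m.+3).[c] - (P m.+3).[z * c]))) by ring.
by rewrite pmulr_rgt0 ?ltr0n // nmulr_rgt0.
Qed.

End TwistedAppellUnit.

(** * Interlacing *)

(** Exactly the first [j] factors are negative at [y]. *)
Lemma prod_XsubC_sign (R : realDomainType) (x : nat -> R) (k j : nat) (y : R) :
  (j <= k)%N -> (forall i, (i < j)%N -> y < x i) ->
  (forall i, (j <= i < k)%N -> x i < y) ->
  0 < (-1) ^+ j * (\prod_(0 <= i < k) ('X - (x i)%:P)).[y].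
Proof.
move=> jk lo hi; rewrite horner_prod (@big_cat_nat _ _ _ j) //= mulrA.
have -> : (-1) ^+ j = \prod_(0 <= i < j) (-1 : R) by rewrite prodr_const_nat subn0.
rewrite -big_split /= mulr_gt0 //; rewrite big_nat prodr_gt0 // => i.
  by move=> /andP[_ ij]; rewrite hornerXsubC mulN1r opprB subr_gt0 lo.
by move=> ij; rewrite hornerXsubC subr_gt0 hi.
Qed.

Lemma decreasing_le (R : numDomainType) (x : nat -> R) k :
  (forall i, (i < k)%N -> x i.+1 < x i) ->
  forall i j, (i <= j)%N -> (j <= k)%N -> x j <= x i.
Proof.
move=> dec i; elim=> [|j IH]; first by rewrite leqn0 => /eqP->.
rewrite leq_eqVlt => /predU1P[->//|]; rewrite ltnS => ij jk.
by apply: le_trans (IH ij (ltnW jk)); apply/ltW/dec.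
Qed.

(** The intermediate value theorem gives a zero in each of the [k] gaps; these zeros are distinct,
    so their linear factors divide [p] together. *)
Lemma alternating_factor (R : rcfType) (p : {poly R}) (x : nat -> R) (k : nat) :
  (forall i, (i < k)%N -> x i.+1 < x i) ->
  (forall i, (i <= k)%N -> 0 < (-1) ^+ i * p.[x i]) ->
  exists y q, p = q * \prod_(0 <= i < k) ('X - (y i)%:P) /\
    forall i, (i < k)%N -> x i.+1 < y i < x i.
Proof.
move=> xdec alt.
have h (i : 'I_k) : {c | c \in `]x i.+1, x i[ & root p c}.
  apply: polyrcf.poly_ivtoo; first exact/ltW/xdec.
  have /(mulr_gt0 (alt i (ltnW (ltn_ord i)))) := alt i.+1 (ltn_ord i).
  have -> : (-1) ^+ i * p.[x i] * ((-1) ^+ i.+1 * p.[x i.+1])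
    = - ((-1) ^+ i) ^+ 2 * (p.[x i.+1] * p.[x i]) by rewrite exprS; ring.
  by rewrite sqrr_sign mulN1r oppr_gt0.
pose y i := if insub i is Some j then s2val (h j) else 0.
have yE (i : 'I_k) : y i = s2val (h i) by rewrite /y insubT //= => ?; congr (s2val (h _)); apply: val_inj.
have yx i : (i < k)%N -> x i.+1 < y i < x i.
  move=> ik; have := s2valP (h (Ordinal ik)).
  by rewrite in_itv /= -(yE (Ordinal ik)).
have ydec i j : (i < j)%N -> (j < k)%N -> y j < y i.
  move=> ij jk; have /andP[_ a] := yx j jk.
  have /andP[b _] := yx i (ltn_trans ij jk).
  by apply: lt_trans b; apply: lt_le_trans a _; apply: (decreasing_le xdec) => //; apply: ltnW.
have [||q pq] := @uniq_roots_prod_XsubC _ p (mkseq y k).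
- apply/allP => c /mapP[i]; rewrite mem_iota add0n => /= ik ->.
  by rewrite (yE (Ordinal ik)); apply: (s2valP' (h _)).
- rewrite uniq_rootsE; apply/mkseq_uniqP => i j; rewrite !inE => ik jk e.
  have [ij|ji|//] := ltngtP i j.
    by have := ydec i j ij jk; rewrite e ltxx.
  by have := ydec j i ji ik; rewrite e ltxx.
by exists y, q; split=> //; rewrite pq big_map /index_iota subn0.
Qed.

(** The gaps account for [k] of the [k.+1] zeros. The remaining factor is monic of degree 1, and the
    sign of [p] at [x k] puts its zero below [x k]. *)
Lemma monic_alternating_factor (R : rcfType) (p : {poly R}) (x : nat -> R) (k : nat) :
  p \is monic -> size p = k.+2 ->
  (forall i, (i < k)%N -> x i.+1 < x i) ->
  (forall i, (i <= k)%N -> 0 < (-1) ^+ i * p.[x i]) ->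
  exists y, [/\ p = \prod_(0 <= i < k.+1) ('X - (y i)%:P),
    forall i, (i <= k)%N -> y i < x i
    & forall i, (i < k)%N -> x i.+1 < y i].
Proof.
move=> pmon sp xdec alt; have [y [q [pq yx]]] := alternating_factor xdec alt.
set m := \prod_(_ <= _ < _) _ in pq.
have mmon : m \is monic by apply: monic_prod => i _; apply: monicXsubC.
have qmon : q \is monic by move: pmon; rewrite pq monicMr.
have sm : size m = k.+1.
  by rewrite /m -(big_map y predT (fun c => 'X - c%:P)) size_prod_XsubC size_map size_iota subn0.
have sq : size q = 2.
  move: sp; rewrite pq size_Mmonic ?monic_neq0 // sm addnS /= => /eqP.
  by rewrite -add2n eqn_add2r => /eqP.
pose c := - q`_0.
have qE : q = 'X - c%:P.
  apply/polyP => -[|[|i]]; rewrite coefB coefX coefC /= ?subr0 ?sub0r ?opprK //.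
    by move/monicP: qmon; rewrite lead_coefE sq.
  by rewrite nth_default ?sq.
pose y' i := if (i == k)%N then c else y i.
have y'E i : (i < k)%N -> y' i = y i by move=> ik; rewrite /y' ltn_eqF.
have pE : p = \prod_(0 <= i < k.+1) ('X - (y' i)%:P).
  rewrite pq big_nat_recr //= mulrC /y' eqxx -qE; congr (_ * _).
  by apply: eq_big_nat => i /andP[_ ik]; rewrite ltn_eqF.
exists y'; split=> // i; last first.
  by move=> ik; rewrite y'E //; case/andP: (yx i ik).
rewrite leq_eqVlt => /predU1P[->|ik]; last by rewrite y'E //; case/andP: (yx i ik).
rewrite /y' eqxx -subr_gt0.
have := alt k (leqnn k); rewrite pq hornerM qE hornerXsubC mulrCA pmulr_lgt0 //.
apply: prod_XsubC_sign => // j; last by case/andP=> /leq_ltn_trans h /h; rewrite ltnn.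
move=> jk; have /andP[h _] := yx j jk; apply: le_lt_trans h.
exact: (decreasing_le xdec).
Qed.

(** After the [k] zeros in the gaps, the cofactor has degree at most 1 and real coefficients, so it
    adds no non-real zero. *)
Lemma alternating_real_rooted (p : {poly algR}) (x : nat -> algR) (k : nat) :
  (size p <= k.+2)%N ->
  (forall i, (i < k)%N -> x i.+1 < x i) ->
  (forall i, (i <= k)%N -> 0 < (-1) ^+ i * p.[x i]) ->
  real_rooted (map_poly algRval p).
Proof.
move=> sp xdec alt; right=> c.
have [y [q [pq yx]]] := alternating_factor xdec alt.
set m := \prod_(_ <= _ < _) _ in pq.
have mmon : m \is monic by apply: monic_prod => i _; apply: monicXsubC.
have p0 : p != 0.
  by apply: contraTneq (alt 0%N isT) => ->; rewrite horner0 mulr0 ltxx.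
have q0 : q != 0 by apply: contraNneq p0 => q0; rewrite pq q0 mul0r.
have sm : size m = k.+1.
  by rewrite /m -(big_map y predT (fun c => 'X - c%:P)) size_prod_XsubC size_map size_iota subn0.
have sq : (size q <= 2)%N.
  by move: sp; rewrite pq size_Mmonic // sm addnS /= -add2n leq_add2r.
rewrite pq rmorphM rootM => /orP[|]; last first.
  rewrite rmorph_prod /= (eq_bigr (fun i => 'X - (algRval (y i))%:P)); last first.
    by move=> i _; rewrite map_polyXsubC.
  rewrite -(big_map (fun i => algRval (y i)) predT (fun c => 'X - c%:P)).
  by rewrite root_prod_XsubC => /mapP[i _ ->]; apply: algRvalP.
rewrite rootE (horner_coef_wide _ (n := 2)) ?size_map_poly //.
rewrite !big_ord_recl big_ord0 addr0 !coef_map /= expr0 mulr1 expr1 => /eqP e.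
have q1 : algRval q`_1 != 0.
  apply: contraNneq q0 => q1; move: e; rewrite q1 mul0r addr0 => e0.
  apply/eqP/polyP => -[|[|i]]; rewrite coef0; try exact: val_inj.
  by rewrite nth_default // (leq_trans sq).
have -> : c = - algRval q`_0 / algRval q`_1.
  apply: (mulIf q1); rewrite divfK // mulrC; apply/eqP; rewrite -addr_eq0 addrC.
  exact/eqP.
by rewrite rpredM ?rpredN ?rpredV ?algRvalP.
Qed.

(** * Excedances and fixed points *)

Lemma ltn_sum_witness (I : finType) (f g : I -> nat) j :
  (forall i, f i <= g i)%N -> (f j < g j)%N -> (\sum_i f i < \sum_i g i)%N.
Proof.
move=> fg fgj; rewrite (bigD1 j) //= [ltnRHS](bigD1 j) //= -addSn leq_add //.
by apply: leq_sum => i _.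
Qed.

Definition nb_exc n (s : 'S_n) : nat := (\sum_(i < n) (i < s i))%N.
Definition nb_fix n (s : 'S_n) : nat := (\sum_(i < n) (s i == i))%N.
Definition nb_wexc n (s : 'S_n) : nat := (\sum_(i < n) (i <= s i))%N.

Lemma nb_wexcE n (s : 'S_n) : nb_wexc s = (nb_exc s + nb_fix s)%N.
Proof.
rewrite -big_split; apply: eq_bigr => i _ /=.
by rewrite leq_eqVlt eq_sym -val_eqE /=; case: ltngtP.
Qed.

Lemma nb_wexc_le n (s : 'S_n) : (nb_wexc s <= n)%N.
Proof.
rewrite -[leqRHS]card_ord -sum1_card; apply: leq_sum => i _; exact: leq_b1.
Qed.

(** If every point is a weak excedance, no inequality [i <= s i] can be strict, since both sides
    have the same sum over [i]. *)
Lemma nb_wexc_full n (s : 'S_n) : (nb_wexc s == n) = (s == 1%g).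
Proof.
apply/eqP/eqP => [full|->]; last first.
  rewrite /nb_wexc (eq_bigr (fun=> 1%N)) ?sum1_card ?card_ord // => i _.
  by rewrite perm1 leqnn.
have le_s (i : 'I_n) : (i <= s i)%N.
  apply: contraT => /negbTE h; move: full; rewrite /nb_wexc (bigD1 i) //= h add0n => e.
  have : (\sum_(j < n | j != i) (j <= s j) <= \sum_(j < n | j != i) 1)%N.
    by apply: leq_sum => j _; exact: leq_b1.
  rewrite e sum1_card leqNgt => /negP[]; rewrite -[ltnRHS]card_ord.
  by apply/proper_card/properP; split; [apply/subsetP | exists i; rewrite // unfold_in eqxx].
apply/permP => i; rewrite perm1; apply/eqP; move: (le_s i); rewrite leq_eqVlt.
case/predU1P => [/val_inj<-//|lt_i].
have : (\sum_(j < n) j < \sum_(j < n) s j)%N.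
  exact: (ltn_sum_witness (j := i)).
by rewrite [ltnLHS](reindex_inj (@perm_inj _ s)) ltnn.
Qed.

Lemma lift_perm_inj n (i : 'I_n.+1) : injective (@lift_perm n i i).
Proof.
move=> s t st; apply/permP => k; apply: (@lift_inj _ i).
by rewrite -!(lift_perm_lift i i) st.
Qed.

Lemma fix_lift_perm n (i : 'I_n.+1) (s : 'S_n.+1) :
  s i = i -> exists t, s = lift_perm i i t.
Proof.
move=> si.
have h k : {k' | s (lift i k) = lift i k'}.
  have : i != s (lift i k) by rewrite -[X in X != _]si (inj_eq perm_inj) neq_lift.
  by case/unlift_some=> k' e _; exists k'.
have f_inj : injective (fun k => sval (h k)).
  move=> k1 k2 /(congr1 (lift i)).
  by rewrite -!(svalP (h _)) => /perm_inj /lift_inj.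
exists (perm f_inj); apply/permP => k.
case: (unliftP i k) => [k'|] ->; rewrite ?lift_perm_id ?lift_perm_lift //.
by rewrite permE; case: (h k').

Qed.

Lemma sum_fix_lift_perm (V : nmodType) n (i : 'I_n.+1) (F : 'S_n.+1 -> V) :
  \sum_(s : 'S_n.+1 | s i == i) F s = \sum_(t : 'S_n) F (lift_perm i i t).
Proof.
rewrite (eq_bigl [in [set lift_perm i i t | t in [set: 'S_n]]]) => [|s].
  rewrite big_imset /=; last by move=> s t _ _; apply: lift_perm_inj.
  by apply: eq_bigl => t; rewrite inE.
apply/eqP/imsetP => [/fix_lift_perm[t ->]|[t _ ->]]; last exact: lift_perm_id.
by exists t.
Qed.

Lemma nb_exc_lift n (i : 'I_n.+1) (t : 'S_n) : nb_exc (lift_perm i i t) = nb_exc t.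
Proof.
rewrite /nb_exc (bigD1_ord i) //= lift_perm_id ltnn; apply: eq_bigr => j _.
by rewrite lift_perm_lift /= ltnNge leq_bump2 -ltnNge.
Qed.

Lemma nb_fix_lift n (i : 'I_n.+1) (t : 'S_n) :
  nb_fix (lift_perm i i t) = (nb_fix t).+1.
Proof.
rewrite /nb_fix (bigD1_ord i) //= lift_perm_id eqxx; congr _.+1.
by apply: eq_bigr => j _; rewrite lift_perm_lift (inj_eq lift_inj).
Qed.

(** Following [s] by the cyclic shift turns [i <= s i] into [i < s i + 1]; only the point [i0], sent
    to the top value and then wrapped to 0, is lost. *)
Lemma nb_exc_shift n (s : 'S_n.+1) :
  (nb_exc (s * perm (@ordS_inj n.+1))%g).+1 = nb_wexc s.
Proof.
pose i0 := (s^-1)%g ord_max.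
rewrite /nb_exc /nb_wexc (bigD1 i0) //= [RHS](bigD1 i0) //=.
rewrite permM permE permKV /= modnn leq_ord; congr _.+1.
apply: eq_bigr => i ii0; rewrite permM permE /= modn_small ?ltnS //.
rewrite ltn_neqAle -ltnS ltn_ord andbT -(inj_eq val_inj) /= in ii0 *.
by apply: contraNneq ii0 => e; rewrite /i0 -(permK s i) (_ : s i = ord_max) //; apply: val_inj.
Qed.

Lemma sum_wexc (R : pzRingType) n (z : R) :
  \sum_(s : 'S_n.+1) z ^+ nb_wexc s = z * \sum_(s : 'S_n.+1) z ^+ nb_exc s.
Proof.
rewrite mulr_sumr [RHS](reindex_inj (mulIg (perm (@ordS_inj n.+1)))) /=.
by apply: eq_bigr => s _; rewrite -exprS nb_exc_shift.
Qed.

(** * Eulerian polynomials and their refinement by fixed points *)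

Definition eulerian (R : nzRingType) n : {poly R} := \sum_(s : 'S_n) 'X^(nb_exc s).

Lemma sum_coef_wexc (R : nzRingType) n (m : nat) :
  (\sum_(s : 'S_n) 'X^(nb_wexc s) : {poly R})`_m = #|[set s : 'S_n | nb_wexc s == m]|%:R.
Proof.
rewrite coef_sum -sum1dep_card natr_sum [RHS]big_mkcond /=.
by apply: eq_bigr => s _; rewrite coefXn eq_sym; case: eqP.
Qed.

Lemma coef_eulerian (R : nzRingType) n (m : nat) :
  (eulerian R n.+1)`_m = #|[set s : 'S_n.+1 | nb_wexc s == m.+1]|%:R.
Proof. by rewrite -sum_coef_wexc sum_wexc coefXM. Qed.

Lemma coef_eulerian_last (R : nzRingType) n : (eulerian R n.+1)`_n = 1.
Proof.
rewrite coef_eulerian (_ : [set _ | _] = [set 1%g]) ?cards1 //.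
by apply/setP => s; rewrite !inE nb_wexc_full.
Qed.

Lemma size_eulerian (R : nzRingType) n : size (eulerian R n.+1) = n.+1.
Proof.
apply/eqP; rewrite eqn_leq; apply/andP; split; last first.
  by apply: contraT; rewrite -ltnNge => /leq_sizeP/(_ n (leqnn n))/eqP; rewrite coef_eulerian_last oner_eq0.
apply/leq_sizeP => m nm; rewrite coef_eulerian (_ : [set _ | _] = set0) ?cards0 //.
apply/setP => s; rewrite !inE; apply: contraTF nm => /eqP e.
by rewrite -leqNgt -ltnS -e nb_wexc_le.
Qed.

Lemma eulerian_monic (R : nzRingType) n : eulerian R n.+1 \is monic.
Proof. by rewrite monicE lead_coefE size_eulerian coef_eulerian_last. Qed.

(* The exponential generating function of this family is
   (1 - z) e^(y x) / (e^(z x) - z e^x). *)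
Definition exc_fix (R : comNzRingType) (z : R) n : {poly R} :=
  \sum_(s : 'S_n) z ^+ nb_exc s *: 'X^(nb_fix s).

Lemma exc_fix0 (R : comNzRingType) (z : R) : exc_fix z 0 = 1.
Proof.
rewrite /exc_fix (big_pred1 1%g) => [|s].
  by rewrite /nb_exc /nb_fix !big_ord0 !expr0 scale1r.
by apply/esym/eqP/permP => -[].
Qed.

(** The derivative marks a fixed point. Deleting it leaves a permutation of [n] points with the same
    number of excedances and one fixed point fewer, and the mark has [n.+1] possible positions. *)
Lemma deriv_exc_fix (R : comNzRingType) (z : R) n :
  (exc_fix z n.+1)^`() = n.+1%:R *: exc_fix z n.
Proof.
rewrite linear_sum /=.
transitivity (\sum_(i < n.+1) \sum_(s : 'S_n.+1 | s i == i)
    z ^+ nb_exc s *: 'X^((nb_fix s).-1) : {poly R}).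
  rewrite (exchange_big_dep predT) //=; apply: eq_bigr => s _.
  rewrite derivZ derivXn sumr_const -scalerMnr; congr (_ *+ _).
  rewrite /nb_fix -sum1_card [RHS]big_mkcond; apply: eq_bigr => i _.
  by rewrite -[i \in _]/(s i == i); case: (s i == i).
rewrite -[n.+1 in RHS]card_ord scaler_nat -sumr_const; apply: eq_bigr => i _.
rewrite sum_fix_lift_perm; apply: eq_bigr => t _.
by rewrite nb_exc_lift nb_fix_lift.
Qed.

Lemma horner_exc_fix (R : comNzRingType) (z y : R) n :
  (exc_fix z n).[y] = \sum_(s : 'S_n) z ^+ nb_exc s * y ^+ nb_fix s.
Proof. by rewrite horner_sum; apply: eq_bigr => s _; rewrite hornerZ hornerXn. Qed.

Lemma horner_eulerian (R : comNzRingType) (z : R) n :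
  (eulerian R n).[z] = (exc_fix z n).[1].
Proof.
rewrite horner_exc_fix horner_sum; apply: eq_bigr => s _.
by rewrite hornerXn expr1n mulr1.
Qed.

(** At [y = z] the exponents add up to the number of weak excedances, to which the cyclic shift
    applies. *)
Lemma exc_fix_twist (R : comNzRingType) (z : R) n :
  (exc_fix z n.+1).[z] = z * (exc_fix z n.+1).[1].
Proof.
rewrite !horner_exc_fix; transitivity (\sum_(s : 'S_n.+1) z ^+ nb_wexc s).
  by apply: eq_bigr => s _; rewrite nb_wexcE exprD.
by rewrite sum_wexc; congr (_ * _); apply: eq_bigr => s _; rewrite expr1n mulr1.
Qed.

(** * Colored derangements *)

Lemma nb_exc_inv n (s : 'S_n) : (nb_exc s^-1 + nb_wexc s = n)%N.
Proof.
rewrite /nb_exc (reindex_inj (@perm_inj _ s)) -big_split /=.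
rewrite -[RHS]card_ord -sum1_card; apply: eq_bigr => i _.
by rewrite permK ltnNge; case: leqP.
Qed.

Lemma nb_fix_inv n (s : 'S_n) : nb_fix s^-1 = nb_fix s.
Proof.
rewrite /nb_fix (reindex_inj (@perm_inj _ s)) /=; apply: eq_bigr => i _.
by rewrite permK eq_sym.
Qed.

Lemma nb_wexc_gt0 n (s : 'S_n.+1) : (0 < nb_wexc s)%N.
Proof. by rewrite -nb_exc_shift. Qed.

Lemma nb_exc_le n (s : 'S_n.+1) : (nb_exc s <= n)%N.
Proof.
rewrite -ltnS -[ltnRHS](nb_exc_inv s^-1) invgK -addn1 leq_add2l; exact: nb_wexc_gt0.
Qed.

Lemma nb_fix_le n (s : 'S_n) : (nb_fix s <= n)%N.
Proof. by apply: leq_trans (nb_wexc_le s); rewrite nb_wexcE leq_addl. Qed.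

Lemma nb_exc_eq0 n (s : 'S_n) : (nb_exc s == 0%N) = (s == 1%g).
Proof.
rewrite -(inj_eq invg_inj) invg1 -nb_wexc_full.
have := nb_exc_inv s^-1; rewrite invgK.
by move: (nb_exc s) (nb_wexc _) => a b; lia.
Qed.

(** The number of colorings that make [s] a colored derangement: a fixed point must avoid color
    0. *)
Definition nb_colorings (r n : nat) (s : 'S_n) : nat :=
  (r ^ (n - nb_fix s) * r.-1 ^ nb_fix s)%N.

Lemma nb_fixE n (s : 'S_n) : #|[pred i | s i == i]| = nb_fix s.
Proof.
rewrite /nb_fix -sum1_card [LHS]big_mkcond; apply: eq_bigr => i _.
by rewrite inE; case: (s i == i).
Qed.

Lemma card_colored_derangement n r (s : 'S_n) :
  #|[pred c | colored_derangement n r s c]| = nb_colorings r s.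
Proof.
have -> : #|[pred c | colored_derangement n r s c]|
    = #|family (fun i : 'I_n => [pred k : 'I_r | (s i == i) ==> (0 < k)%N])|.
  by apply: eq_card => c; apply/forallP/familyP.
rewrite card_family foldrE big_map big_enum /=.
transitivity (\prod_(i < n) (if s i == i then r.-1 else r))%N.
  apply: eq_bigr => i _; case: (s i == i) => /=; last by rewrite card_ord.
  case: r => [|r]; first by apply: eq_card0 => -[].
  by rewrite -[r in RHS]/(r.+1.-1) -[r.+1 in RHS]card_ord -(cardC1 ord0); apply: eq_card => -[[]].
rewrite (bigID (fun i => s i == i)) /= mulnC /nb_colorings; congr (_ * _)%N.
  rewrite (eq_bigr (fun=> r)) => [|i /negbTE->] //; rewrite prod_nat_const.
  congr (r ^ _)%N; have := cardC [pred i | s i == i]; rewrite nb_fixE card_ord.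
  by move=> /(congr1 (subn^~ (nb_fix s))); rewrite addKn => <-; apply: eq_card.
by rewrite (eq_bigr (fun=> r.-1)) => [|i ->] //; rewrite prod_nat_const nb_fixE.
Qed.

(** In a colored derangement every fixed point has nonzero color, so the excedances are exactly the
    weak excedances of [s]. *)
Lemma colored_derangement_polyE n r :
  colored_derangement_poly n r
  = \sum_(s : 'S_n) (nb_colorings r s)%:R *: 'X^(nb_wexc s).
Proof.
apply: eq_bigr => s _; rewrite (eq_bigr (fun=> 'X^(nb_wexc s))) => [|c /forallP dc].
  by rewrite sumr_const card_colored_derangement scaler_nat.
congr 'X^_; rewrite /colored_exc -sum1dep_card [LHS]big_mkcond.
apply: eq_bigr => i _.
have -> : (i <= s i)%N = (i < s i)%N || (s i == i).
  by rewrite leq_eqVlt orbC -val_eqE eq_sym.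
by case: (s i == i) (dc i) => /= [->|_]; rewrite ?andbT // ?orbT ?orbF; case: ltnP.
Qed.

(** Stated over any ring, so that signs can be studied over [algR] and the result transported to
    [algC]. *)
Definition derangement_poly (R : comNzRingType) (r n : nat) : {poly R} :=
  \sum_(s : 'S_n) (nb_colorings r s)%:R *: 'X^(nb_wexc s).

Definition derangement_poly_rev (R : comNzRingType) (r n : nat) : {poly R} :=
  \sum_(s : 'S_n) (nb_colorings r s)%:R *: 'X^(nb_exc s).

Lemma coef_derangement_poly (R : comNzRingType) r n k :
  (derangement_poly R r n)`_k
  = (\sum_(s : 'S_n | nb_wexc s == k) nb_colorings r s)%:R.
Proof.
rewrite coef_sum natr_sum [RHS]big_mkcond; apply: eq_bigr => s _.
by rewrite coefZ coefXn eq_sym; case: eqP; rewrite ?mulr1 ?mulr0.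
Qed.

Lemma coef_derangement_poly_rev (R : comNzRingType) r n k :
  (derangement_poly_rev R r n)`_k
  = (\sum_(s : 'S_n | nb_exc s == k) nb_colorings r s)%:R.
Proof.
rewrite coef_sum natr_sum [RHS]big_mkcond; apply: eq_bigr => s _.
by rewrite coefZ coefXn eq_sym; case: eqP; rewrite ?mulr1 ?mulr0.
Qed.

(** Inverting a permutation keeps its fixed points and exchanges [k] excedances with [n - k] weak
    excedances. *)
Lemma derangement_polyK (R : comNzRingType) r n k : (k <= n)%N ->
  (derangement_poly_rev R r n)`_k = (derangement_poly R r n)`_(n - k).
Proof.
move=> kn; rewrite coef_derangement_poly coef_derangement_poly_rev; congr _%:R.
rewrite (reindex_inj invg_inj) /=; apply: eq_big => s.
  by have := nb_exc_inv s; move: (nb_exc _) (nb_wexc _) kn => a b; lia.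
by rewrite /nb_colorings nb_fix_inv.
Qed.

Lemma size_derangement_poly (R : comNzRingType) r n :
  (size (derangement_poly R r n) <= n.+1)%N.
Proof.
apply/leq_sizeP => k nk; rewrite coef_derangement_poly big_pred0 // => s.
by apply: contraTF nk => /eqP<-; rewrite -leqNgt nb_wexc_le.
Qed.

Lemma size_derangement_poly_rev (R : comNzRingType) r n :
  (size (derangement_poly_rev R r n.+1) <= n.+1)%N.
Proof.
apply/leq_sizeP => k nk; rewrite coef_derangement_poly_rev big_pred0 // => s.
by apply: contraTF nk => /eqP<-; rewrite -leqNgt nb_exc_le.
Qed.

Lemma coef0_derangement_poly (R : comNzRingType) r n :
  (derangement_poly R r n.+1)`_0 = 0.
Proof.
rewrite coef_derangement_poly big_pred0 // => s.
by rewrite eqn0Ngt nb_wexc_gt0.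
Qed.

Lemma coef0_derangement_poly_rev (R : comNzRingType) r n :
  (derangement_poly_rev R r n)`_0 = (r.-1 ^ n)%:R.
Proof.
rewrite coef_derangement_poly_rev (big_pred1 1%g); last by move=> s; rewrite nb_exc_eq0.
rewrite /nb_colorings (_ : nb_fix 1%g = n) ?subnn ?mul1n //.
rewrite /nb_fix (eq_bigr (fun=> 1%N)) ?sum1_card ?card_ord // => i _.
by rewrite perm1 eqxx.
Qed.

(** The inverse of the full cycle has one weak excedance and no fixed point, so it alone contributes
    [r ^ n.+2]. *)
Lemma coef1_derangement_poly_ge r n :
  (r ^ n.+2 <= \sum_(s : 'S_n.+2 | nb_wexc s == 1) nb_colorings r s)%N.
Proof.
pose c : 'S_n.+2 := perm (@ordS_inj n.+2).
have w1 : nb_wexc c^-1 = 1%N.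
  rewrite -nb_exc_shift mulVg; apply/eqP; rewrite eqSS nb_exc_eq0 //.
have f0 : nb_fix c^-1 = 0%N.
  rewrite nb_fix_inv /nb_fix big1 // => i _; rewrite permE -val_eqE /=.
  have [lt|] := ltnP i.+1 n.+2; first by rewrite modn_small // gtn_eqF.
  move=> ge; have -> : i.+1 = n.+2 by apply/eqP; rewrite eqn_leq ge ltn_ord.
  by rewrite modnn; case: (i : nat) ge.
rewrite (bigD1 c^-1%g) /= ?w1 // /nb_colorings f0 subn0 muln1; exact: leq_addr.
Qed.

Lemma horner_derangement_poly1 (R : comNzRingType) r n :
  (derangement_poly R r n).[1] = (derangement_poly_rev R r n).[1].
Proof.
rewrite !horner_sum; apply: eq_bigr => s _.
by rewrite !hornerZ !hornerXn !expr1n.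
Qed.

(** With one color only permutations without fixed points contribute, and for them weak and strict
    excedances coincide. *)
Lemma derangement_poly1 (R : comNzRingType) n :
  derangement_poly R 1 n = derangement_poly_rev R 1 n.
Proof.
apply: eq_bigr => s _; rewrite nb_wexcE /nb_colorings.
by case: (nb_fix s) => [|k]; rewrite ?addn0 // exp0n // muln0 !scale0r.
Qed.

Lemma nb_colorings_natr (F : fieldType) r n (s : 'S_n) : r%:R != 0 :> F ->
  (nb_colorings r s)%:R = r%:R ^+ n * (r.-1%:R / r%:R) ^+ nb_fix s :> F.
Proof.
move=> r0; rewrite natrM !natrX expr_div_n.
have /(congr1 (fun k => r%:R ^+ k : F)) := subnK (nb_fix_le s); rewrite exprD => <-.
by field; rewrite expf_neq0.
Qed.

Lemma horner_derangement_poly (F : fieldType) r n (z : F) : r%:R != 0 :> F ->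
  (derangement_poly F r n).[z]
  = r%:R ^+ n * (exc_fix z n).[z * (r.-1%:R / r%:R)].
Proof.
move=> r0; rewrite horner_exc_fix horner_sum mulr_sumr; apply: eq_bigr => s _.
rewrite hornerZ hornerXn nb_colorings_natr // nb_wexcE exprD.
by rewrite !exprMn; ring.
Qed.

Lemma horner_derangement_poly_rev (F : fieldType) r n (z : F) : r%:R != 0 :> F ->
  (derangement_poly_rev F r n).[z]
  = r%:R ^+ n * (exc_fix z n).[r.-1%:R / r%:R].
Proof.
move=> r0; rewrite horner_exc_fix horner_sum mulr_sumr; apply: eq_bigr => s _.
by rewrite hornerZ hornerXn nb_colorings_natr // -!mulrA [X in _ * X]mulrC.
Qed.

Lemma map_derangement_poly (R S : comNzRingType) (f : {rmorphism R -> S}) r n :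
  map_poly f (derangement_poly R r n) = derangement_poly S r n.
Proof.
rewrite rmorph_sum; apply: eq_bigr => s _.
by rewrite /= map_polyZ map_polyXn rmorph_nat.
Qed.

Lemma map_derangement_poly_rev (R S : comNzRingType) (f : {rmorphism R -> S}) r n :
  map_poly f (derangement_poly_rev R r n) = derangement_poly_rev S r n.
Proof.
rewrite rmorph_sum; apply: eq_bigr => s _.
by rewrite /= map_polyZ map_polyXn rmorph_nat.
Qed.

Lemma coef0_eulerian (R : nzRingType) n : (eulerian R n)`_0 = 1.
Proof.
have E (s : 'S_n) : ('X^(nb_exc s) : {poly R})`_0 = (s == 1%g)%:R.
  by rewrite coefXn -nb_exc_eq0 eq_sym.
rewrite coef_sum (bigD1 1%g) //= big1 => [|s /negbTE s1]; first by rewrite E eqxx addr0.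
by rewrite E s1.
Qed.

(** * Real-rootedness *)

(** Sample points: 0, where a value is just the constant coefficient, followed by the negative zeros
    of an Eulerian polynomial. *)
Definition with_zero (R : nmodType) (x : nat -> R) (i : nat) : R :=
  if i is j.+1 then x j else 0.

Lemma with_zero_lt0 (R : numDomainType) (x : nat -> R) k :
  (forall i, (i < k)%N -> with_zero x i.+1 < with_zero x i) ->
  forall i, (i < k)%N -> x i < 0.
Proof.
move=> dec; elim=> [|i IH] ik; first exact: (dec 0%N).
by apply: lt_trans (IH (ltnW ik)); apply: (dec i.+1).
Qed.

(** The induction carries the signs of [eulerian R k] at the zeros of [eulerian R k.+1]. The step
    rule turns them into signs of [eulerian R k.+2] there, which locates the next zeros; interlacing
    then yields the next signs. *)
Lemma eulerian_zeros (R : rcfType) k : exists x : nat -> R,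
  [/\ forall i, (i < k)%N -> with_zero x i.+1 < with_zero x i,
      eulerian R k.+1 = \prod_(0 <= i < k) ('X - (x i)%:P)
    & forall i, (i < k)%N -> 0 < (-1) ^+ i * (eulerian R k).[x i]].
Proof.
elim: k => [|k [x [xdec fact alt]]].
  exists (fun=> 0); split=> //; rewrite big_geq //.
  apply/eqP; rewrite -[_ == 1]/(_ == 1%:P); apply/eqP.
  have s1 : (size (eulerian R 1) <= 1)%N by rewrite size_eulerian.
  by rewrite (size1_polyC s1) coef_eulerian_last.
have x0 := with_zero_lt0 xdec.
have [|y [fact' yx xy]] := monic_alternating_factor (eulerian_monic R k.+1) (size_eulerian R k.+1) xdec.
  case=> [_|i ik] /=.
    by rewrite expr0 mul1r horner_coef0 coef0_eulerian ltr01.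
  have zi := x0 i ik; case: k ik alt fact {xdec x0} => // k ik alt fact.
  have e0 : (exc_fix (x i) k.+2).[1] = 0.
    rewrite -horner_eulerian fact horner_prod big_mkord.
    by apply/eqP/prodf_eq0; exists (Ordinal ik); rewrite //= hornerXsubC subrr.
  have a := alt i ik; have n0 : (exc_fix (x i) k.+1).[1] != 0.
    by apply: contraTneq a; rewrite -horner_eulerian => ->; rewrite mulr0 ltxx.
  have := twisted_step_sign (exc_fix0 _) (deriv_exc_fix _) zi (exc_fix_twist _) e0 n0.
  rewrite -!horner_eulerian => s.
  rewrite -(pmulr_rgt0 _ a) exprS.
  have -> : (-1) ^+ i * (eulerian R k.+1).[x i] * (-1 * (-1) ^+ i * (eulerian R k.+3).[x i])
    = - ((-1) ^+ i) ^+ 2 * ((eulerian R k.+1).[x i] * (eulerian R k.+3).[x i]) by ring.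
  by rewrite sqrr_sign mulN1r oppr_gt0.
exists y; split=> //.
  by case=> [|i] ik; [exact: (yx 0%N) | apply: lt_trans (xy i ik); exact: (yx i.+1)].
(* By interlacing, exactly [i] of the old zeros exceed [y i]. *)
move=> i ik; rewrite fact; apply: prod_XsubC_sign => // [j ji|j /andP[ij jk]].
  apply: lt_le_trans (yx i _) _; first by rewrite -ltnS.
  by apply: (decreasing_le xdec (i := j.+1)) => //; rewrite -ltnS.
apply: le_lt_trans (xy i (leq_ltn_trans ij jk)).
exact: (decreasing_le xdec (i := i.+1) (j := j.+1)).
Qed.

(** The points 2, 3, ... already determine a polynomial. This serves identities whose proof divides
    by [1 - z]. *)
Lemma poly_eq_horner_neq1 (R : numFieldType) (p q : {poly R}) :
  (forall z, z != 1 -> p.[z] = q.[z]) -> p = q.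
Proof.
move=> pq; apply/eqP; rewrite -subr_eq0; apply/negP => /negP nz.
have := @max_poly_roots _ (p - q) [seq i.+2%:R | i <- iota 0 (size (p - q))] nz.
rewrite size_map size_iota ltnn => h; suff: false by []; apply: h.
  apply/allP => z /mapP[i _ ->]; rewrite rootE hornerD hornerN pq ?subrr //.
  by rewrite (eqr_nat _ _ 1).
by rewrite map_inj_uniq ?iota_uniq // => i j /eqP; rewrite eqr_nat => /eqP[].
Qed.

Lemma size_le1_real_rooted (p : {poly algC}) : (size p <= 1)%N -> real_rooted p.
Proof.
move=> /size1_polyC->; have [->|p0] := eqVneq p`_0 0; first by left.
by right=> z; rewrite rootC (negbTE p0).
Qed.

Lemma one_subX_neq0 (R : nzRingType) : 1 - 'X != 0 :> {poly R}.
Proof. by rewrite subr_eq0 eq_sym -subr_eq0 polyXsubC_eq0. Qed.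

Lemma size_one_subX_mul (R : idomainType) (p : {poly R}) n :
  (size ((1 - 'X) * p)%R <= n.+1)%N -> (size p <= n)%N.
Proof.
have [->|p0] := eqVneq p 0; first by rewrite size_poly0.
by rewrite size_mul ?one_subX_neq0 // -opprB size_polyN -polyC1 size_XsubC.
Qed.

(** As [u] vanishes at 1, the division by [1 - 'X] can already be carried out over [algR]. *)
Lemma one_subX_descend (p : {poly algC}) (u : {poly algR}) :
  u.[1] = 0 -> (1 - 'X) * p = map_poly algRval u ->
  exists pR, p = map_poly algRval pR /\ (1 - 'X) * pR = u.
Proof.
move=> u1 pu; have /factor_theorem[v uv] : root u 1 by apply/eqP.
exists (- v); have e : (1 - 'X) * - v = u by rewrite uv mulrN -mulNr opprB mulrC.
split=> //; apply: (mulfI (one_subX_neq0 _)).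
by rewrite pu -e rmorphM rmorphB /= map_polyX rmorph1.
Qed.

(** The signs of [p] alternate at 0 and the zeros of [eulerian _ n.-1], by [twisted_diff_sign]
    between [x i * q] and [q]. Length 1 gives a constant and one color gives 0. *)
Lemma derangement_diff_real_rooted n r (p : {poly algC}) : (0 < n)%N -> (0 < r)%N ->
  (1 - 'X) * p = derangement_poly_rev _ r n - derangement_poly _ r n ->
  real_rooted p.
Proof.
move=> n0 r0; rewrite -!(map_derangement_poly_rev algRval) -!(map_derangement_poly algRval).
rewrite -rmorphB => /one_subX_descend[]; first by rewrite !hornerE horner_derangement_poly1 subrr.
move=> b [-> eb] {p}.
have szb : (size b <= n)%N.
  apply: size_one_subX_mul; rewrite eb (leq_trans (size_polyD _ _)) // size_polyN geq_max.
  case: n n0 {eb} => // n _.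
  by rewrite (leqW (size_derangement_poly_rev _ _ _)) size_derangement_poly.
case: n n0 szb eb => // -[|n] _ szb eb.
  by apply: size_le1_real_rooted; rewrite size_map_poly.
case: r r0 eb => // -[|r] _ eb.
  left; move: eb; rewrite derangement_poly1 subrr => /eqP.
  by rewrite mulf_eq0 (negbTE (one_subX_neq0 _)) => /eqP->; rewrite rmorph0.
have r0 : r.+2%:R != 0 :> algR by rewrite pnatr_eq0.
pose q : algR := r.+1%:R / r.+2%:R.
have q0 : 0 < q by rewrite divr_gt0 ?ltr0n.
have q1 : q < 1 by rewrite ltr_pdivrMr ?ltr0n // mul1r ltr_nat.
have [x [xdec fact alt]] := eulerian_zeros algR n.
have x0 := with_zero_lt0 xdec.
apply: (@alternating_real_rooted b (with_zero x) n) => // -[|i] ik /=.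
  (* At the sample point 0 the value is the constant coefficient of the reversed polynomial, a power
     of [r.+1]. *)
  have /(congr1 (coefp 0)) := eb; rewrite /= coef0M coefB coef1 coefX subr0 mul1r.
  rewrite coefB coef0_derangement_poly coef0_derangement_poly_rev subr0 => h.
  by rewrite expr0 mul1r horner_coef0 h ltr0n expn_gt0.
have zi := x0 i ik; have z1 : x i < 1 by apply: lt_trans zi ltr01.
case: n ik alt fact eb {szb xdec x0} => // n ik alt fact eb.
have e0 : (exc_fix (x i) n.+2).[1] = 0.
  rewrite -horner_eulerian fact horner_prod big_mkord.
  by apply/eqP/prodf_eq0; exists (Ordinal ik); rewrite //= hornerXsubC subrr.
have a := alt i ik; have n0 : (exc_fix (x i) n.+1).[1] != 0.
  by apply: contraTneq a; rewrite -horner_eulerian => ->; rewrite mulr0 ltxx.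
have := twisted_diff_sign (exc_fix0 _) (deriv_exc_fix _) zi (exc_fix_twist _) e0 n0.
move=> /(_ (x i * q) q _ _ (ltW q1)).
rewrite -horner_eulerian => s.
have {}s : (eulerian algR n.+1).[x i] * ((1 - x i) * b.[x i]) < 0.
  have ex := congr1 (horner^~ (x i)) eb; rewrite /= !hornerE in ex; rewrite ex.
  rewrite horner_derangement_poly // horner_derangement_poly_rev // -mulrBr.
  rewrite mulrCA pmulr_rlt0 ?exprn_gt0 ?ltr0n //; apply: s.
    by rewrite ler_nMr // ltW.
  by rewrite (lt_trans _ q0) // nmulr_rlt0.
rewrite -(pmulr_rgt0 _ a) exprS -(pmulr_rgt0 _ (_ : 0 < 1 - x i)) ?subr_gt0 //.
have -> : (1 - x i) * ((-1) ^+ i * (eulerian algR n.+1).[x i] * (-1 * (-1) ^+ i * b.[x i]))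
  = - ((-1) ^+ i) ^+ 2 * ((eulerian algR n.+1).[x i] * ((1 - x i) * b.[x i])) by ring.
by rewrite sqrr_sign mulN1r oppr_gt0.
Qed.

(** The same sampling applies to [p] divided by ['X], now at 0 and the zeros of [eulerian _ n.-2],
    with [twisted_combination_sign]. Lengths 1 and 2 leave only a constant quotient. *)
Lemma derangement_combination_real_rooted n r (p : {poly algC}) : (0 < n)%N -> (0 < r)%N ->
  (1 - 'X) * p = derangement_poly _ r n - 'X * derangement_poly_rev _ r n ->
  real_rooted p.
Proof.
move=> n0 r0; rewrite -!(map_derangement_poly_rev algRval) -!(map_derangement_poly algRval).
rewrite -{2}(map_polyX algRval) -rmorphM -rmorphB => /one_subX_descend[].
  by rewrite !hornerE horner_derangement_poly1 subrr.
case: n n0 => // n _ a [-> ea] {p}.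
have sza : (size a <= n.+1)%N.
  apply: size_one_subX_mul; rewrite ea (leq_trans (size_polyD _ _)) // size_polyN geq_max.
  rewrite size_derangement_poly (leq_trans (size_polyMleq _ _)) // size_polyX.
  by rewrite ltnS size_derangement_poly_rev.
have /factor_theorem[c ac] : root a 0.
  have /(congr1 (coefp 0)) := ea; rewrite /= coef0M coefB coef1 coefX subr0 mul1r.
  by rewrite coefB coef0_derangement_poly coefXM subr0 rootE horner_coef0 => ->.
move: ac; rewrite subr0 => ac.
have szc : (size c <= n)%N.
  have [->|c0] := eqVneq c 0; first by rewrite size_poly0.
  by move: sza; rewrite ac size_mulX.
suff [c0|c0] : real_rooted (map_poly algRval c).
- by left; rewrite ac rmorphM /= c0 mul0r.
- right=> z; rewrite ac rmorphM rootM => /orP[/c0//|].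
  by rewrite /= map_polyX rootX => /eqP->; rewrite rpred0.
case: n szc sza ea => [|n] szc sza ea.
  by apply: size_le1_real_rooted; rewrite size_map_poly (leq_trans szc).
case: n szc sza ea => [|n] szc sza ea.
  by apply: size_le1_real_rooted; rewrite size_map_poly.
have rn0 : r%:R != 0 :> algR by rewrite pnatr_eq0 -lt0n.
pose q : algR := r.-1%:R / r%:R.
have q0 : 0 <= q by rewrite divr_ge0 ?ler0n.
have q1 : q < 1 by rewrite ltr_pdivrMr ?ltr0n // mul1r ltr_nat prednK.
have [x [xdec fact alt]] := eulerian_zeros algR n.
have x0 := with_zero_lt0 xdec.
apply: (@alternating_real_rooted c (with_zero x) n) => // -[|i] ik /=.
  (* The value of [c] at 0 is the linear coefficient of the derangement polynomial, at least
     [r ^ n.+3], minus [r.-1 ^ n.+3]. *)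
  have /(congr1 (coefp 1)) := ea.
  rewrite ac /= !coefB mulrBl mul1r coefB coefXM coefMX /= coefXM coefMX /= subr0.
  rewrite coef_derangement_poly coef0_derangement_poly_rev => h.
  rewrite expr0 mul1r horner_coef0 h subr_gt0 ltr_nat.
  apply: leq_trans (coef1_derangement_poly_ge _ _).
  by rewrite ltn_exp2r // prednK.
have zi := x0 i ik; have z1 : x i < 1 by apply: lt_trans zi ltr01.
case: n ik alt fact ea {szc sza xdec x0} => // n ik alt fact ea.
have e0 : (exc_fix (x i) n.+2).[1] = 0.
  rewrite -horner_eulerian fact horner_prod big_mkord.
  by apply/eqP/prodf_eq0; exists (Ordinal ik); rewrite //= hornerXsubC subrr.
have a' := alt i ik; have n0 : (exc_fix (x i) n.+1).[1] != 0.
  by apply: contraTneq a'; rewrite -horner_eulerian => ->; rewrite mulr0 ltxx.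
have := twisted_combination_sign (exc_fix0 _) (deriv_exc_fix _) zi (exc_fix_twist _) e0 n0.
move=> /(_ q); rewrite q0 q1 -horner_eulerian => /(_ isT) s.
have {}s : 0 < (eulerian algR n.+1).[x i] * ((1 - x i) * (c.[x i] * x i)).
  have ex := congr1 (horner^~ (x i)) ea; rewrite ac /= !hornerE in ex.
  rewrite -[X in X = _]/((1 - x i) * c.[x i] * x i) -mulrA in ex; rewrite ex.
  rewrite horner_derangement_poly // horner_derangement_poly_rev //.
  by rewrite [X in _ - X]mulrCA -mulrBr mulrCA pmulr_rgt0 ?exprn_gt0 ?ltr0n ?lt0n // -(pnatr_eq0 algR).
(* Since [x i < 0], passing from [a] to [c] flips the sign. *)
have w : 0 < (1 - x i) * - x i by rewrite mulr_gt0 ?subr_gt0 ?oppr_gt0.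
rewrite -(pmulr_rgt0 _ a') exprS -(pmulr_rgt0 _ w).
have -> : (1 - x i) * - x i * ((-1) ^+ i * (eulerian algR n.+1).[x i] * (-1 * (-1) ^+ i * c.[x i]))
  = ((-1) ^+ i) ^+ 2 * ((eulerian algR n.+1).[x i] * ((1 - x i) * (c.[x i] * x i))) by ring.
by rewrite sqrr_sign mul1r.
Qed.

(** * Iterated differences *)

Lemma deriv_eq0_const (R : numDomainType) (p : {poly R}) :
  p^`() = 0 -> p = (p`_0)%:P.
Proof.
move=> dp; apply: size1_polyC; apply/leq_sizeP => -[//|j] _.
have := congr1 (coefp j) dp; rewrite /= coef_deriv coef0 => /eqP.
by rewrite mulrn_eq0 => /eqP.
Qed.

(** Taylor's formula: by the Appell relation the [k]-th derivative is a falling factorial times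
    [exc_fix z (n - k)]. *)
Lemma exc_fix_taylor (F : numFieldType) (z x h : F) n :
  (exc_fix z n).[x + h]
  = \sum_(k < n.+1) ('C(n, k))%:R * h ^+ k * (exc_fix z (n - k)).[x].
Proof.
have dn k : (k <= n)%N -> (exc_fix z n)^`(k) = (n ^_ k)%:R *: exc_fix z (n - k).
  elim: k => [|k IH] kn; first by rewrite derivn0 ffactn0 scale1r subn0.
  have e : (n - k = (n - k.+1).+1)%N by rewrite subnSK.
  by rewrite derivnS IH ?(ltnW kn) // derivZ e deriv_exc_fix scalerA -natrM -e ffactnSr.
have sz : (size (exc_fix z n) <= n.+1)%N.
  apply: (leq_trans (size_sum _ _ _)); apply/bigmax_leqP => s _.
  by rewrite (leq_trans (size_scale_leq _ _)) // size_polyXn ltnS nb_fix_le.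
rewrite (nderiv_taylor_wide (mulrC _ _) sz); apply: eq_bigr => k _.
have kn : (k <= n)%N by rewrite -ltnS.
suff -> : (exc_fix z n)^`N(k) = ('C(n, k))%:R *: exc_fix z (n - k).
  by rewrite hornerZ mulrAC.
apply: (@mulIf _ (k`!)%:R%:P); first by rewrite polyC_eq0 pnatr_eq0 -lt0n fact_gt0.
rewrite mulrC mul_polyC scaler_nat -nderivn_def dn // -bin_ffact natrM.
by rewrite [RHS]mulrC mul_polyC scalerA mulrC.
Qed.

(** The [k]-th forward difference, with step [r], of the monomial of degree [n]. *)
Definition fdiff (R : comNzRingType) (r : R) (k n : nat) : {poly R} :=
  iter k (fun p => p \Po ('X + r%:P) - p) 'X^n.
Arguments fdiff : simpl never.

Lemma fdiffS (R : comNzRingType) (r : R) k n :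
  fdiff r k.+1 n = fdiff r k n \Po ('X + r%:P) - fdiff r k n.
Proof. by []. Qed.

Lemma deriv_fdiff (R : comNzRingType) (r : R) k n :
  (fdiff r k n)^`() = n%:R *: fdiff r k n.-1.
Proof.
elim: k => [|k IH]; first by rewrite derivXn scaler_nat.
rewrite !fdiffS derivB deriv_comp IH derivD derivX derivC addr0 mulr1.
by rewrite comp_polyZ scalerBr.
Qed.

(** By induction the derivative of the previous difference is 0; that difference is constant, and
    one more difference kills it. *)
Lemma fdiff_small (R : numDomainType) (r : R) k n : (n < k)%N -> fdiff r k n = 0.
Proof.
elim: n k => [|n IH] [//|k] nk.
  elim: k {nk} => [|k IH]; rewrite fdiffS; last by rewrite IH comp_poly0 subrr.
  by rewrite /fdiff /= expr0 comp_polyC subrr.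
rewrite fdiffS (deriv_eq0_const (_ : (fdiff r k n.+1)^`() = 0)).
  by rewrite comp_polyC subrr.
by rewrite deriv_fdiff /= IH // scaler0.
Qed.

Lemma fdiff_const (R : numDomainType) (r x y : R) n :
  (fdiff r n n).[x] = (fdiff r n n).[y].
Proof.
rewrite (deriv_eq0_const (_ : (fdiff r n n)^`() = 0)) ?hornerC //.
rewrite deriv_fdiff; case: n => [|n]; first by rewrite scale0r.
by rewrite fdiff_small ?scaler0 //=.
Qed.

(* A finite form of (1 - z) * sum_(j >= 0) (t + j r)^n z^j. *)
Definition geom_fdiff (F : fieldType) (z r : F) (n : nat) : {poly F} :=
  \sum_(k < n.+1) (z / (1 - z)) ^+ k *: fdiff r k n.

(** With [u = z / (1 - z)], multiplying the sum of the next differences by [u] shifts the index: the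
    first term [t ^ n] is lost and the new last one is zero. *)
Lemma geom_fdiff_shift (F : numFieldType) (z r t : F) n : z != 1 ->
  (geom_fdiff z r n).[t] = z * (geom_fdiff z r n).[t + r] + (1 - z) * t ^+ n.
Proof.
move=> z1; have z1' : 1 - z != 0 by rewrite subr_eq0 eq_sym.
set u := z / (1 - z); have uz : z = u * (1 - z) by rewrite divfK.
rewrite !horner_sum.
have -> : \sum_(k < n.+1) (u ^+ k *: fdiff r k n).[t + r]
   = \sum_(k < n.+1) u ^+ k * (fdiff r k.+1 n).[t] + \sum_(k < n.+1) (u ^+ k *: fdiff r k n).[t].
  rewrite -big_split; apply: eq_bigr => k _ /=.
  by rewrite !hornerZ -mulrDr fdiffS hornerD hornerN horner_comp !hornerE subrK.
have : u * \sum_(k < n.+1) u ^+ k * (fdiff r k.+1 n).[t]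
   = \sum_(k < n.+1) (u ^+ k *: fdiff r k n).[t] - t ^+ n.
  rewrite mulr_sumr [in LHS]big_ord_recr [in RHS]big_ord_recl /=.
  rewrite fdiff_small // horner0 !mulr0 addr0 hornerZ expr0 mul1r.
  rewrite -[fdiff r 0 n]/('X^n) hornerXn addrAC subrr add0r.
  by apply: eq_bigr => k _; rewrite hornerZ mulrA -exprS.
set S := \sum_(k < _) _; set T := \sum_(k < _) _ => e.
transitivity ((1 - z) * (u * T) + z * S + (1 - z) * t ^+ n); first by rewrite e; ring.
by rewrite mulrA [(1 - z) * u]mulrC -uz mulrDr.
Qed.

Lemma deriv_geom_fdiff (F : numFieldType) (z r : F) n :
  (geom_fdiff z r n.+1)^`() = n.+1%:R *: geom_fdiff z r n.
Proof.
rewrite linear_sum big_ord_recr /= derivZ deriv_fdiff fdiff_small // !scaler0 addr0.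
rewrite scaler_sumr; apply: eq_bigr => k _.
by rewrite derivZ deriv_fdiff !scalerA mulrC.
Qed.

(* Both sides are Appell sequences with the same twisted periodicity. *)
Lemma geom_fdiffE (F : numFieldType) (z r : F) n : z != 1 -> r != 0 ->
  (1 - z) ^+ n *: geom_fdiff z r n
  = r ^+ n *: (exc_fix z n \Po (z%:P + ((1 - z) / r) *: 'X)).
Proof.
move=> z1 r0; have z1' : 1 - z != 0 by rewrite subr_eq0 eq_sym.
elim: n => [|n IH].
  by rewrite !expr0 !scale1r exc_fix0 comp_polyC /geom_fdiff big_ord1 expr0 scale1r.
apply/eqP; rewrite -subr_eq0; set D := _ - _.
have dD : D^`() = 0.
  rewrite derivB !derivZ deriv_geom_fdiff deriv_comp deriv_exc_fix.
  rewrite derivD derivC derivZ derivX add0r comp_polyZ.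
  rewrite -scalerAl scalerA mulrC exprS scalerA.
  apply/eqP; rewrite subr_eq0; apply/eqP.
  transitivity ((n.+1%:R * (1 - z)) *: ((1 - z) ^+ n *: geom_fdiff z r n)).
    by rewrite scalerA; congr (_ *: _); ring.
  rewrite IH -[_ *: 1]/(_ %:A) mulr_algr !scalerA; congr (_ *: _).
  by rewrite exprS; field.
(* [D] is constant; equal to [z] times itself with [z != 1], it is 0. *)
have tD : D.[0] = z * D.[r].
  rewrite !(hornerD, hornerN, hornerZ, horner_comp, hornerC, hornerX) mulr0 addr0.
  rewrite divfK // (addrC z) subrK exc_fix_twist geom_fdiff_shift // add0r expr0n /=.
  by ring.
have c D0 : D = D0%:P -> D0 = z * D0 by move=> e; move: tD; rewrite e !hornerC.
have := deriv_eq0_const dD; set D0 := D`_0 => e.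
have /eqP := c _ e; rewrite e polyC_eq0 -subr_eq0 -{1}[D0]mul1r -mulrBl mulf_eq0.
by rewrite (negbTE z1').
Qed.

(** * Faces of the edgewise subdivision *)

(** In the second case [S] is the largest member of the chain that misses [i]. *)
Lemma chain_cut_below n (C : pred {set 'I_n}) (i : 'I_n) :
  (forall S T, C S -> C T -> S \subset T \/ T \subset S) ->
  (forall T, C T -> i \in T) \/
  exists2 S, C S & forall T, C T -> (i \notin T) = (T \subset S).
Proof.
move=> chain; have [S0 /andP[CS0 iS0]|none] := pickP (fun S => C S && (i \notin S)); last first.
  by left=> T CT; have := none T; rewrite CT => /negbFE.
right; have [S /andP[CS iS] maxS] := @arg_maxnP _ S0 (fun S => C S && (i \notin S))
  (fun S => #|S|) (introT andP (conj CS0 iS0)).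
exists S => // T CT; apply/idP/idP => [iT|TS]; last by apply: contra iS => /(subsetP TS).
have [//|ST] := chain _ _ CT CS.
suff /eqP -> : S == T by [].
by rewrite eqEcard ST; apply: maxS; rewrite CT.
Qed.

(** In the second case [i] is taken outside [S] in the smallest member of the chain not contained in
    [S]. *)
Lemma chain_cut_above n (C : pred {set 'I_n}) (S : {set 'I_n}) :
  (forall S T, C S -> C T -> S \subset T \/ T \subset S) -> C S ->
  (forall T, C T -> T \subset S) \/
  exists i, forall T, C T -> (i \notin T) = (T \subset S).
Proof.
move=> chain CS.
have [T0 /andP[CT0 TS0]|none] := pickP (fun T => C T && ~~ (T \subset S)); last first.
  by left=> T CT; have := none T; rewrite CT => /negbFE.
right; have [T1 /andP[CT1 TS1] minT1] := @arg_minnP _ T0 (fun T => C T && ~~ (T \subset S))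
  (fun T => #|T|) (introT andP (conj CT0 TS0)).
have /subsetPn[i iT1 iS] := TS1.
exists i => T CT; apply/idP/idP => [iT|TS]; last by apply: contra iS => /(subsetP TS).
apply: contraR iT => TS; have [T1T|TT1] := chain _ _ CT1 CT.
  exact: (subsetP T1T).
suff /eqP -> : T == T1 by [].
by rewrite eqEcard TT1; apply: minT1; rewrite CT.
Qed.

(** * Levels of vertices and the face condition *)

Section Levels.

Variables n r : nat.
Implicit Types (x y z : esd_vertex n r) (S T F : {set 'I_n}) (G : {set esd_vertex n r}).

(* Together these coordinates identify a vertex with a point of {0, ..., r}^n
   whose largest coordinate is r. *)
Definition esd_level x (i : 'I_n) : nat := (\sum_(T : {set 'I_n} | i \in T) (val x T : nat))%N.

Lemma esd_vertex0 x : val x set0 = ord0.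
Proof. by have /and3P[/eqP] := valP x. Qed.

Lemma esd_vertex_sum x : (\sum_(S : {set 'I_n}) (val x S : nat) = r)%N.
Proof. by have /and3P[_ /eqP] := valP x. Qed.

Lemma esd_supp_chain x S T : esd_supp x S -> esd_supp x T -> S \subset T \/ T \subset S.
Proof.
have /and3P[_ _ /forallP/(_ S)/forallP/(_ T)/implyP h] := valP x.
by move=> xS xT; apply/orP/h/andP.
Qed.

Lemma esd_suppPn x S : ~~ esd_supp x S -> (val x S : nat) = 0%N.
Proof. by rewrite negbK => /eqP->. Qed.

Lemma esd_supp_gt0 x S : esd_supp x S = (0 < val x S)%N.
Proof. by rewrite /esd_supp -val_eqE lt0n. Qed.

Lemma esd_levelC x i : (esd_level x i + \sum_(T : {set 'I_n} | i \notin T) val x T = r)%N.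
Proof.
apply: (etrans _ (esd_vertex_sum x)).
by rewrite [RHS](bigID (fun T : {set 'I_n} => i \in T)).
Qed.

Lemma esd_level_le x i : (esd_level x i <= r)%N.
Proof. by apply: leq_trans (leq_addr _ _) (eq_leq (esd_levelC x i)). Qed.

Lemma esd_level_phi x i S :
  (forall T, esd_supp x T -> (i \notin T) = (T \subset S)) ->
  (esd_phi x S + esd_level x i = r)%N.
Proof.
move=> h; rewrite addnC; apply: (etrans _ (esd_levelC x i)); congr (_ + _)%N.
rewrite /esd_phi big_mkcond [RHS]big_mkcond; apply: eq_bigr => T _.
have [/h->//|/esd_suppPn->] := boolP (esd_supp x T).
by case: ifP; case: ifP.
Qed.

Lemma esd_level_full x i : (forall T, esd_supp x T -> i \in T) -> esd_level x i = r.
Proof.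
move=> h; apply: (etrans _ (esd_levelC x i)); rewrite [X in _ = (_ + X)%N]big1 ?addn0 // => T iT.
by apply: esd_suppPn; apply: contra iT => /h.
Qed.

Lemma esd_phi_full x S : (forall T, esd_supp x T -> T \subset S) -> esd_phi x S = r.
Proof.
move=> h; apply: (etrans _ (esd_vertex_sum x)); rewrite [RHS](bigID (fun T : {set 'I_n} => T \subset S)) /=.
rewrite [X in _ = (_ + X)%N]big1 ?addn0 // => T TS.
by apply: esd_suppPn; apply: contra TS => /h.
Qed.

Lemma esd_level_gt0 x S i : esd_supp x S -> i \in S -> (0 < esd_level x i)%N.
Proof. by rewrite esd_supp_gt0 /esd_level => xS iS; rewrite (bigD1 S) //= addn_gt0 xS. Qed.

Lemma esd_level_ltP x i j :
  reflect (exists S, [/\ esd_supp x S, j \in S & i \notin S]) (esd_level x i < esd_level x j)%N.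
Proof.
apply: (iffP idP) => [|[S [xS jS iS]]].
  have [S /and3P[xS jS iS]|none] :=
      pickP (fun S => [&& esd_supp x S, j \in S & i \notin S]); first by exists S.
  rewrite ltnNge => /negP[]; rewrite /esd_level big_mkcond [leqRHS]big_mkcond.
  apply: leq_sum => S _; have := none S; case: (boolP (esd_supp x S)) => /= [_|/esd_suppPn->].
    by case: (j \in S) => //= /negbFE->.
  by case: ifP.
rewrite /esd_level big_mkcond [ltnRHS]big_mkcond; apply: (ltn_sum_witness (j := S)).
  move=> T; case: ifP => // iT; case: ifP => // /negbT jT.
  have [xT|/esd_suppPn->//] := boolP (esd_supp x T).
  case: (esd_supp_chain xS xT) => /subsetP sub; first by rewrite sub in jT.
  by rewrite sub in iS.
by rewrite jS (negbTE iS) -esd_supp_gt0.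
Qed.

Definition level_ordcomp x y : Prop :=
  forall i j, (esd_level x i < esd_level x j)%N -> (esd_level y i <= esd_level y j)%N.

(** A strict inequality of levels is witnessed by a support set separating the two coordinates;
    incomparable support sets give strict inequalities in opposite directions. *)
Lemma level_ordcompP x y :
  (forall S T, esd_supp x S -> esd_supp y T -> S \subset T \/ T \subset S)
  <-> level_ordcomp x y.
Proof.
split=> [comp i j /esd_level_ltP[S [xS jS iS]]|comp S T xS yT].
  rewrite leqNgt; apply/negP => /esd_level_ltP[T [yT iT jT]].
  have [/subsetP/(_ j jS)|/subsetP/(_ i iT)] := comp S T xS yT; first by rewrite (negbTE jT).
  by rewrite (negbTE iS).
have [|/subsetPn[j jS jT]] := boolP (S \subset T); first by left.
have [|/subsetPn[i iT iS]] := boolP (T \subset S); first by right.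
have : (esd_level x i < esd_level x j)%N by apply/esd_level_ltP; exists S.
move=> /comp; rewrite leqNgt => /negP[].
by apply/esd_level_ltP; exists T.
Qed.

Lemma diff01_compl a b c d : (a + b = r -> c + d = r -> diff01 a c = diff01 d b)%N.
Proof. by rewrite /diff01; lia. Qed.

Lemma diff01_refl a : diff01 a a.
Proof. by rewrite /diff01 eqxx. Qed.

(** At a cut of the chain, partial sum and level add up to [r], so complementing exchanges [x] and
    [y]. Where there is no cut, both sides equal [r]. *)
Lemma diff01_levelP (C : pred {set 'I_n}) x y :
  (forall S T, C S -> C T -> S \subset T \/ T \subset S) ->
  (forall S, esd_supp x S -> C S) -> (forall S, esd_supp y S -> C S) ->
  (forall S, C S -> diff01 (esd_phi x S) (esd_phi y S))
  <-> (forall i, diff01 (esd_level y i) (esd_level x i)).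
Proof.
move=> chain xC yC; split=> [h i|h S CS].
  have [all_i|[S CS cut]] := chain_cut_below i chain.
    by rewrite !esd_level_full ?diff01_refl // => T; [move/xC | move/yC]; apply: all_i.
  rewrite -(diff01_compl (a := esd_phi x S) (c := esd_phi y S)) ?h //.
    by apply: esd_level_phi => T /xC/cut.
  by apply: esd_level_phi => T /yC/cut.
have [all_S|[i cut]] := chain_cut_above chain CS.
  by rewrite !esd_phi_full ?diff01_refl // => T; [move/yC | move/xC]; apply: all_S.
rewrite (diff01_compl (b := esd_level x i) (d := esd_level y i)) ?h //.
  by apply: esd_level_phi => T /xC/cut.
by apply: esd_level_phi => T /yC/cut.
Qed.

Definition level_compatible x y : Prop :=
  level_ordcomp x y /\
  ((forall i, diff01 (esd_level x i) (esd_level y i))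
   \/ (forall i, diff01 (esd_level y i) (esd_level x i))).

(** In terms of levels the face condition becomes purely pairwise and no longer refers to the union
    of all supports. *)
Lemma esd_faceP G :
  reflect (forall x y, x \in G -> y \in G -> level_compatible x y) (esd_face G).
Proof.
pose C S := [exists z in G, esd_supp z S].
have suppC x : x \in G -> forall S, esd_supp x S -> C S.
  by move=> xG S xS; apply/exists_inP; exists x.
apply: (iffP forall_inP) => [face|comp].
  have comp x y : x \in G -> y \in G ->
      forall S T, esd_supp x S -> esd_supp y T -> S \subset T \/ T \subset S.
    move=> xG yG S T xS yT; have /forall_inP/(_ y yG)/andP[h _] := face x xG.
    by have /forallP/(_ S)/forallP/(_ T) := h; rewrite xS yT => /orP.
  have chain S T : C S -> C T -> S \subset T \/ T \subset S.
    by move=> /exists_inP[x xG xS] /exists_inP[y yG yT]; apply: (comp x y).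
  move=> x y xG yG; split; first exact/level_ordcompP/comp.
  have /forall_inP/(_ y yG)/andP[_ /orP[]] := face x xG => /forallP h; [right|left];
    by apply/(diff01_levelP chain (suppC _ _) (suppC _ _)) => // S CS;
       have /implyP := h S; apply.
have chain S T : C S -> C T -> S \subset T \/ T \subset S.
  move=> /exists_inP[x xG xS] /exists_inP[y yG yT].
  by have [/level_ordcompP h _] := comp x y xG yG; apply: h.
move=> x xG; apply/forall_inP => y yG; have [/level_ordcompP ord diff] := comp x y xG yG.
apply/andP; split.
  by apply/forallP => S; apply/forallP => T; apply/implyP => /andP[xS yT]; apply/orP/ord.
by case: diff => h; apply/orP; [right|left]; apply/forallP => S; apply/implyP => CS;
  apply: (iffRL (diff01_levelP chain (suppC _ _) (suppC _ _)) h).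
Qed.

End Levels.

Lemma sum_ord_ltn r m : (m <= r)%N -> (\sum_(k < r) (k < m) = m)%N.
Proof.
move=> mr; rewrite -[RHS]card_ord -sum1_card (big_ord_widen _ (fun=> 1%N) mr).
by rewrite [RHS]big_mkcond; apply: eq_bigr => k _; case: ltnP.
Qed.

(** Hermite's identity: with [p] the remainder of [a], exactly the last [p] shifts raise the
    quotient by 1. *)
Lemma sum_divn_shift a m : (0 < m)%N -> (\sum_(k < m) (a + k) %/ m = a)%N.
Proof.
move=> m0; set q := (a %/ m)%N; set p := (a %% m)%N.
have pm : (p < m)%N by rewrite ltn_mod.
have E (k : 'I_m) : ((a + k) %/ m = q + (k >= m - p))%N.
  rewrite (divn_eq a m) -/q -/p -addnA divnMDl //; congr (_ + _)%N.
  case: leqP => h; last by rewrite divn_small // -ltn_subRL.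
  have -> : (p + k = 1 * m + (p + k - m))%N by have := ltn_ord k; lia.
  by rewrite divnMDl // divn_small ?addn0 //; have := ltn_ord k; lia.
rewrite (eq_bigr _ (fun k _ => E k)) big_split /= sum_nat_const card_ord.
rewrite [RHS](divn_eq a m) mulnC; congr (_ + _)%N.
rewrite (reindex_inj rev_ord_inj) /= -[RHS](sum_ord_ltn (ltnW pm)).
by apply: eq_bigr => k _; congr nat_of_bool; have := ltn_ord k; lia.
Qed.

(** * Vertices as integer points *)

Section Vertices.

Variables n r : nat.
Implicit Types (x y z : esd_vertex n r) (S T F : {set 'I_n}) (G : {set esd_vertex n r}).

(** Equal levels give equal partial sums on the union of the supports, a chain; the weights follow
    by induction on the size of the set. *)
Lemma esd_level_inj x y : esd_level x =1 esd_level y -> x = y.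
Proof.
move=> lxy.
have comp : level_ordcomp x y by move=> i j; rewrite -!lxy; apply: ltnW.
have compxy := iffRL (level_ordcompP x y) comp.
pose C S := esd_supp x S || esd_supp y S.
have chain S T : C S -> C T -> S \subset T \/ T \subset S.
  case/orP=> h /orP[] h'; [exact: esd_supp_chain h h'|exact: compxy| |exact: esd_supp_chain h h'].
  by case: (compxy _ _ h' h); [right|left].
have phi S : C S -> esd_phi x S = esd_phi y S.
  move=> CS; have xC T : esd_supp x T -> C T by rewrite /C => ->.
  have yC T : esd_supp y T -> C T by rewrite /C => ->; rewrite orbT.
  have e1 i : diff01 (esd_level y i) (esd_level x i) by rewrite lxy diff01_refl.
  have e2 i : diff01 (esd_level x i) (esd_level y i) by rewrite lxy diff01_refl.
  have := iffRL (diff01_levelP chain xC yC) e1 S CS.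
  have := iffRL (diff01_levelP chain yC xC) e2 S CS.
  by rewrite /diff01; lia.
have xy S : (val x S : nat) = val y S.
  have [k] := ubnP #|S|; elim: k S => // k IH S; rewrite ltnS => Sk.
  have [CS|] := boolP (C S); last first.
    by rewrite negb_or => /andP[/esd_suppPn-> /esd_suppPn->].
  have := phi S CS; rewrite /esd_phi (bigD1 S) //= [in RHS](bigD1 S) //=.
  rewrite (eq_bigr (fun T => val y T : nat)); first by move/addIn.
  move=> T /andP[TS neqTS]; apply: IH; apply: leq_trans Sk.
  by apply: proper_card; rewrite properEneq neqTS TS.
by apply/val_inj/ffunP => S; apply/val_inj/xy.
Qed.

(** The superlevel sets [L k], [k < r], form a chain, and [S] gets as weight its number of
    occurrences among them. They are nonempty because the value [r] is attained. *)
Lemma esd_level_surj (v : 'I_n -> nat) : (forall i, v i <= r)%N ->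
  (exists i, v i = r) -> (0 < r)%N -> exists x, forall i, esd_level x i = v i.
Proof.
move=> vr [i0 vi0] r0; pose L (k : nat) := [set i | (k < v i)%N].
have Lmono k l : (k <= l)%N -> L l \subset L k.
  by move=> kl; apply/subsetP => i; rewrite !inE; apply: leq_ltn_trans.
pose c S := (\sum_(k < r) (L k == S))%N.
have cr S : (c S <= r)%N.
  by rewrite -[leqRHS]card_ord -sum1_card; apply: leq_sum => k _; apply: leq_b1.
pose f := [ffun S => inord (c S) : 'I_r.+1].
have fE S : (f S : nat) = c S by rewrite ffunE inordK ?ltnS ?cr.
have c0 S : (0 < c S)%N -> exists k : 'I_r, L k = S.
  have [k /eqP e _|none] := pickP (fun k : 'I_r => L k == S); first by exists k.
  by rewrite /c big1 // => k _; rewrite none.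
have fP : esd_vertex_pred n r f.
  apply/and3P; split.
  - rewrite -val_eqE /= fE; apply: contraT; rewrite -lt0n => /c0[k /setP/(_ i0)].
    by rewrite !inE vi0 ltn_ord.
  - rewrite (eq_bigr c) => [|S _]; last exact: fE.
    rewrite exchange_big /= -[X in _ == X]card_ord -sum1_card; apply/eqP.
    apply: eq_bigr => k _; rewrite (bigD1 (L k)) //= eqxx big1 // => S.
    by rewrite eq_sym => /negbTE->.
  apply/forallP => S; apply/forallP => T; apply/implyP.
  rewrite -!val_eqE /= !fE -!lt0n => /andP[/c0[k <-] /c0[l <-]].
  by have [/ltnW|] := ltnP k l => /Lmono ->; rewrite ?orbT.
exists (exist _ f fP) => i; rewrite /esd_level /=.
rewrite (eq_bigr c) => [|S _]; last exact: fE.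
rewrite exchange_big /= -[RHS](sum_ord_ltn (vr i)); apply: eq_bigr => k _.
have [ki|ik] := ltnP k (v i).
  rewrite (bigD1 (L k)) ?inE //= eqxx big1 // => S /andP[_].
  by rewrite eq_sym => /negbTE->.
rewrite big1 // => S iS; apply/eqP; rewrite eqb0; apply: contraTneq iS => <-.
by rewrite inE -leqNgt.
Qed.

(** Any element of the smallest support set lies in all of them. *)
Lemma esd_level_max x : (0 < r)%N -> exists i, esd_level x i = r.
Proof.
move=> r0.
have [S0 xS0|none] := pickP (esd_supp x); last first.
  have := esd_vertex_sum x; rewrite big1 => [r00|S _]; first by rewrite -r00 in r0.
  by apply: esd_suppPn; rewrite none.
have [S xS minS] := @arg_minnP _ S0 (esd_supp x) (fun S => #|S|) xS0.
have [i iS] : exists i, i \in S.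
  apply/set0Pn; apply: contraTneq xS => ->.
  by rewrite /esd_supp esd_vertex0 eqxx.
exists i; apply: esd_level_full => T xT.
have [ST|TS] := esd_supp_chain xS xT; first exact: (subsetP ST).
by suff /eqP -> : T == S by []; rewrite eqEcard TS minS.
Qed.

Lemma esd_level_supp F x :
  (forall S, esd_supp x S -> S \subset F) <-> (forall i, i \notin F -> esd_level x i = 0%N).
Proof.
split=> [h i iF|h S xS].
  apply: big1 => S iS; apply: esd_suppPn; apply: contra iF => /h/subsetP; exact.
apply/subsetP => i iS; apply: contraT => /h e.
by have := esd_level_gt0 xS iS; rewrite e.
Qed.

End Vertices.

(** * Faces and the sums of their vertices *)

Section FaceBijection.

Variables (n r k : nat).
Hypothesis r0 : (0 < r)%N.
Let m := k.+1.
Implicit Types (x y z : esd_vertex n r) (F : {set 'I_n}) (G : {set esd_vertex n r}).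

Definition face_sum G (i : 'I_n) : nat := (\sum_(x in G) esd_level x i)%N.

(** Position of [x] in the face; the total of the levels serves as a linear order. *)
Definition face_rank G x : nat :=
  #|[set y in G | \sum_i esd_level y i < \sum_i esd_level x i]|%N.

Lemma face_rank_lt G x : x \in G -> (face_rank G x < #|G|)%N.
Proof.
move=> xG; apply/proper_card/properP; split; first by apply/subsetP => y; rewrite inE => /andP[].
by exists x => //; rewrite inE ltnn andbF.
Qed.

Lemma face_below G x y i : esd_face G -> x \in G -> y \in G ->
  (\sum_i esd_level y i <= \sum_i esd_level x i)%N ->
  (esd_level y i <= esd_level x i <= (esd_level y i).+1)%N.
Proof.
move=> /esd_faceP comp xG yG le_yx; have [_ [h|h]] := comp x y xG yG.
  by have := h i; rewrite /diff01 => /orP[/eqP->|/eqP->]; rewrite ?leqnn ?leqnSn.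
have yx j : (esd_level x j <= esd_level y j)%N.
  by have := h j; rewrite /diff01 => /orP[/eqP->|/eqP->].
suff -> : esd_level y i = esd_level x i by rewrite leqnn leqnSn.
apply/eqP; rewrite eqn_leq yx andbT leqNgt; apply: contraTN le_yx => lt_i.
by rewrite -ltnNge; apply: (ltn_sum_witness (j := i)).
Qed.

(* The vertices of a face are ordered by [<=] on levels and differ by at most 1
   in each coordinate, so they are the roundings of their average. *)
Lemma face_level G x i : esd_face G -> #|G| = m -> x \in G ->
  esd_level x i = ((face_sum G i + face_rank G x) %/ m)%N.
Proof.
move=> Gf Gm xG; set L := esd_level x i.
(* [A] lies below [x] and [B] above; levels are within 1 of [L] on the respective side, which
   squeezes the quotient. *)
pose A := [set y in G | \sum_i esd_level y i < \sum_i esd_level x i]%N.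
pose B := [set y in G | ~~ (\sum_i esd_level y i < \sum_i esd_level x i)%N & y != x].
have GE : face_sum G i = (L + \sum_(y in B) esd_level y i + \sum_(y in A) esd_level y i)%N.
  rewrite /face_sum (bigID (fun y => y \in A)) /= addnC; congr (_ + _)%N.
    rewrite (bigD1 x) /=; last by rewrite xG inE ltnn andbF.
    by congr (_ + _)%N; apply: eq_bigl => y; rewrite !inE; case: (y \in G).
  by apply: eq_bigl => y; rewrite !inE; case: (y \in G).
have card_m : (#|B| + #|A| + 1 = m)%N.
  rewrite -Gm -[in RHS]sum1_card (bigID (fun y => y \in A)) /= [RHS]addnC (bigD1 x) /=; last first.
    by rewrite xG inE ltnn andbF.
  rewrite addnC addnA; congr (1 + _ + _)%N; rewrite -sum1_card; apply: eq_bigl => y;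
    by rewrite !inE; case: (y \in G).
have A_le : (\sum_(y in A) esd_level y i <= #|A| * L)%N.
  rewrite -sum_nat_const; apply: leq_sum => y; rewrite inE => /andP[yG /ltnW yx].
  by have /andP[] := face_below i Gf xG yG yx.
have A_ge : (#|A| * L <= \sum_(y in A) esd_level y i + #|A|)%N.
  rewrite -sum_nat_const -[X in (_ <= _ + X)%N]sum1_card -big_split.
  apply: leq_sum => y; rewrite inE => /andP[yG /ltnW yx].
  by have /andP[_] := face_below i Gf xG yG yx; rewrite /= addn1.
have B_le : (\sum_(y in B) esd_level y i <= #|B| * L + #|B|)%N.
  rewrite -[X in (_ <= X + _)%N]sum_nat_const -[X in (_ <= _ + X)%N]sum1_card -big_split.
  apply: leq_sum => y; rewrite inE -leqNgt => /and3P[yG xy _].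
  by have /andP[_] := face_below i Gf yG xG xy; rewrite /= addn1.
have B_ge : (#|B| * L <= \sum_(y in B) esd_level y i)%N.
  rewrite -sum_nat_const; apply: leq_sum => y; rewrite inE -leqNgt => /and3P[yG xy _].
  by have /andP[] := face_below i Gf yG xG xy.
have -> : face_rank G x = #|A| by [].
apply/eqP; rewrite eqn_leq leq_divRL // -[X in _ && X]ltnS ltn_divLR // GE -card_m.
by apply/andP; split; nia.
Qed.

(** The rank determines the vertex by the formula for its levels, so all [m] ranks occur. *)
Lemma face_rank_onto G c : esd_face G -> #|G| = m -> (c < m)%N ->
  exists2 x, x \in G & face_rank G x = c.
Proof.
move=> Gf Gm cm; pose rk x : 'I_m := inord (face_rank G x).
have rkE x : x \in G -> (rk x : nat) = face_rank G x.
  by move=> /face_rank_lt; rewrite Gm => lt_m; rewrite /rk inordK.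
have rk_inj : {in G &, injective rk}.
  move=> x y xG yG /(congr1 val) /=; rewrite !rkE // => e.
  by apply: esd_level_inj => i; rewrite !(face_level i Gf Gm) // e.
have rk_onto : rk @: G = setT.
  by apply/eqP; rewrite eqEcard subsetT cardsT card_ord card_in_imset // Gm leqnn.
have : Ordinal cm \in rk @: G by rewrite rk_onto inE.
by case/imsetP => x xG e; exists x => //; rewrite -rkE // -e.
Qed.

Lemma face_sum_inj G G' : esd_face G -> #|G| = m -> esd_face G' -> #|G'| = m ->
  face_sum G =1 face_sum G' -> G = G'.
Proof.
move=> Gf Gm G'f G'm e; apply/eqP; rewrite eqEcard Gm G'm leqnn andbT.
apply/subsetP => x xG; have xm : (face_rank G x < m)%N by rewrite -Gm face_rank_lt.
have [x' x'G' rx'] := face_rank_onto G'f G'm xm.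
rewrite (_ : x = x') //; apply: esd_level_inj => i.
by rewrite (face_level i Gf Gm xG) (face_level i G'f G'm x'G') rx' e.
Qed.

(* The last condition says that the points floor((w + c) / m), c < m, are
   pairwise distinct. *)
Definition face_weight F (w : 'I_n -> nat) : Prop :=
  [/\ forall i, i \notin F -> w i = 0%N, forall i, (w i <= r * m)%N,
      exists i, w i = (r * m)%N
    & forall c, (0 < c < m)%N -> exists i, (w i %% m = c)%N].

Lemma face_sum_weight F G : esd_face_in F G -> #|G| = m -> face_weight F (face_sum G).
Proof.
case/andP=> Gf /forall_inP GF Gm; split=> [i iF|i||c cm].
- apply: big1 => x xG; apply: (iffLR (esd_level_supp F x)) iF => S.
  by have /forallP/(_ S)/implyP := GF x xG.
- rewrite mulnC -Gm -sum_nat_const; apply: leq_sum => x _; exact: esd_level_le.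
(* The vertex of rank 0 has level [r] at some [i], which forces the sum there to be [r * m]. *)
- have [x xG rx] := face_rank_onto Gf Gm (ltn0Sn k).
  have [i ix] := esd_level_max x r0; exists i.
  have h : (r <= (face_sum G i + 0) %/ m)%N by rewrite -rx -(face_level i Gf Gm xG) ix.
  apply/eqP; rewrite eqn_leq; apply/andP; split; last by rewrite addn0 leq_divRL in h.
  rewrite mulnC -Gm -sum_nat_const; apply: leq_sum => z _; exact: esd_level_le.
have [/andP[c0 cm']] := (cm, cm).
have [i /eqP e|none] := pickP (fun i => face_sum G i %% m == c)%N; first by exists i.
(* The vertices of ranks [m - c - 1] and [m - c] differ only where the sum is [c] modulo [m];
   without such a coordinate they would coincide. *)
have [d dE] : exists d, (m - c = d.+1)%N by exists (m - c).-1; lia.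
have dm : (d.+1 < m)%N by lia.
have [x xG rx] := face_rank_onto Gf Gm dm.
have [y yG ry] := face_rank_onto Gf Gm (ltnW dm).
have xy : x = y.
  apply: esd_level_inj => i; rewrite (face_level i Gf Gm xG) (face_level i Gf Gm yG) rx ry.
  rewrite addnS divnS // addnC -[RHS]addn0; congr (_ + _)%N.
  apply/eqP; rewrite eqb0; apply: contraFN (none i) => /dvdnP[q e].
  have -> : (face_sum G i = q.-1 * m + c)%N by move: e; case: q => [|q]; lia.
  by rewrite modnMDl modn_small.
by move: rx; rewrite xy ry => /eqP; rewrite eqn_leq ltnn andbF.
Qed.

Lemma weight_face_sum F (w : 'I_n -> nat) : face_weight F w ->
  exists G, [/\ esd_face_in F G, #|G| = m & face_sum G =1 w].
Proof.
case=> wF wle [i0 wi0] wres.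
have h (c : 'I_m) : exists x, forall i, esd_level x i = ((w i + c) %/ m)%N.
  apply: esd_level_surj => // [i|].
    by rewrite -ltnS ltn_divLR //; have := wle i; have := ltn_ord c; lia.
  by exists i0; rewrite wi0 divnMDl // divn_small ?addn0.
have [X XE] := fin_all_exists h.
have X_lt (c d : 'I_m) : (c < d)%N -> X c <> X d.
  (* At a coordinate of residue [m - d], adding [d] reaches a multiple of [m] while adding [c] falls
     short. *)
  move=> cd; have cd' : (0 < m - d < m)%N by have := ltn_ord d; lia.
  have [i wi] := wres _ cd' => /(congr1 (fun x => esd_level x i)); rewrite !XE.
  move/eqP; rewrite ltn_eqF //.
  have e := divn_eq (w i) m; rewrite wi in e; set q := (w i %/ m)%N in e.
  have dm := ltn_ord d; have ed : (w i + d = q.+1 * m)%N by rewrite mulSn; lia.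
  by rewrite ed mulnK // ltn_divLR // mulSn; lia.
have X_inj : injective X.
  move=> c d e; apply/val_inj; have [/X_lt/(_ e)//|dc|//] := ltngtP c d.
  by case: (X_lt _ _ dc).
exists [set X c | c : 'I_m]; split.
- apply/andP; split.
    apply/esd_faceP => _ _ /imsetP[c _ ->] /imsetP[d _ ->]; split.
      move=> i j; rewrite !XE => lt_ij; apply: leq_div2r; rewrite leq_add2r.
      apply: contraTT lt_ij; rewrite -ltnNge -leqNgt => /ltnW lt_ji.
      by apply: leq_div2r; rewrite leq_add2r.
    have diff (c' d' : 'I_m) i : (c' <= d')%N ->
        diff01 (esd_level (X d') i) (esd_level (X c') i).
      move=> cd; rewrite !XE /diff01.
      have l1 : ((w i + c') %/ m <= (w i + d') %/ m)%N by apply: leq_div2r; rewrite leq_add2l.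
      have l2 : ((w i + d') %/ m <= (1 * m + (w i + c')) %/ m)%N.
        by apply: leq_div2r; have := ltn_ord d'; lia.
      by move: l2 l1; rewrite divnMDl // add1n; lia.
    by have [/ltnW|] := ltnP c d => cd; [right|left] => i; apply: diff.
  apply/forall_inP => _ /imsetP[c _ ->]; apply/forallP => S; apply/implyP.
  apply: (iffRL (esd_level_supp F (X c))) => i iF.
  by rewrite XE wF // add0n divn_small.
- by rewrite card_imset // card_ord.
move=> i; rewrite /face_sum big_imset /=; last by move=> c d _ _; apply: X_inj.
rewrite -[RHS](sum_divn_shift (w i) (ltn0Sn k)).
by apply: eq_big => [c|c _]; rewrite ?inE ?XE.
Qed.

End FaceBijection.

(** * Functions meeting prescribed blocks *)

Section CountHits.

Variables (I Y : finType) (y0 : Y) (F : {set I}).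

Definition hits (f : {ffun I -> Y}) (B : {set Y}) : bool := [exists i, f i \in B].

(* Functions F -> T meeting every block of Bs, extended by y0 outside F. *)
Definition hitting (T : {set Y}) (Bs : seq {set Y}) : {set {ffun I -> Y}} :=
  [set f in pffun_on y0 (mem F) (mem T) | all (hits f) Bs].

Lemma mem_pffun_on (T : {set Y}) (f : {ffun I -> Y}) :
  reflect ((forall i, i \notin F -> f i = y0) /\ (forall i, i \in F -> f i \in T))
          (f \in pffun_on y0 (mem F) (mem T)).
Proof. by apply: (iffP (pfamilyP (F := fun=> mem T))) => -[/supportP]. Qed.

(** Avoiding [B] means taking values in [T :\: B]; the default [y0] used outside [F] must not count
    as a hit. *)
Lemma card_hitting_cons (T B : {set Y}) (Bs : seq {set Y}) : y0 \notin B ->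
  (#|hitting T (B :: Bs)| + #|hitting (T :\: B) Bs| = #|hitting T Bs|)%N.
Proof.
move=> y0B; rewrite -[RHS](cardsID [set f | hits f B]); congr (_ + _)%N.
  by apply: eq_card => f; rewrite !inE /= -andbA [hits f B && _]andbC.
apply: eq_card => f; rewrite !inE andbA; congr (_ && _).
apply/mem_pffun_on/andP => [[sF fT]|[nB /mem_pffun_on[sF fT]]].
  split; last by apply/mem_pffun_on; split=> // i /fT; rewrite inE => /andP[].
  apply/existsP => -[i]; apply/negP; have [/fT|/sF->//] := boolP (i \in F).
  by rewrite inE => /andP[].
split=> // i iF; rewrite inE fT // andbT; apply: contra nB => fB.
by apply/existsP; exists i.
Qed.

(** Removing one block is one difference with step [r]; [t] counts the elements of [T] outside all
    blocks. *)
Lemma card_hitting (R : comNzRingType) r (Bs : seq {set Y}) (T : {set Y}) t :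
  pairwise (fun A B : {set Y} => [disjoint A & B]) Bs ->
  (forall B, B \in Bs -> [/\ B \subset T, #|B| = r & y0 \notin B]) ->
  (#|T| = t + r * size Bs)%N ->
  #|hitting T Bs|%:R = (fdiff r%:R (size Bs) #|F|).[t%:R] :> R.
Proof.
elim: Bs T t => [|B Bs IH] T t /=.
  rewrite muln0 addn0 => _ _ Tt; rewrite /fdiff /= hornerXn -natrX -Tt.
  congr _%:R; rewrite -(card_pffun_on y0 (mem F) (mem T)).
  by apply: eq_card => f; rewrite inE andbT.
case/andP=> /allP disB disBs BsT Tt.
have [BT Br y0B] := BsT B (mem_head _ _).
have BsT' C : C \in Bs -> [/\ C \subset T, #|C| = r & y0 \notin C].
  by move=> CBs; apply: BsT; rewrite inE CBs orbT.
have := card_hitting_cons T Bs y0B => /(congr1 (fun a => a%:R : R)); rewrite natrD.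
rewrite (IH T (t + r)%N) // => [|]; last by rewrite Tt mulnS addnA.
rewrite (IH (T :\: B) t) //; last first.
- by rewrite cardsD (setIidPr BT) Tt Br mulnS; lia.
- move=> C CBs; have [CT Cr y0C] := BsT' C CBs; split=> //.
  by rewrite subsetD CT disjoint_sym disB.
move=> e; rewrite fdiffS hornerD hornerN horner_comp !hornerE -natrD -e.
by rewrite addrK.
Qed.

End CountHits.

(** * Face numbers as differences *)

Section FaceCount.

Variables (n r k : nat).
Hypothesis r0 : (0 < r)%N.
Let m := k.+1.
Implicit Types (F : {set 'I_n}).

Let Y := 'I_(r * m).+1.

Definition residue_block (c : nat) : {set Y} := [set y : Y | y %% m == c]%N.

Lemma card_residue_block c : (0 < c < m)%N -> #|residue_block c| = r.
Proof.
move=> /andP[c0 cm].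
have lt (q : 'I_r) : (q * m + c < (r * m).+1)%N.
  by have := leq_mul (ltn_ord q) (leqnn m); rewrite mulSn; lia.
have -> : residue_block c = [set (inord (q * m + c) : Y) | q : 'I_r].
  apply/setP => y; rewrite inE; apply/eqP/imsetP => [e|[q _ ->]].
    have lt_q : (y %/ m < r)%N.
      have := ltn_ord y; rewrite ltnS {1}(divn_eq y m) e => h.
      by rewrite -(ltn_pmul2r (ltn0Sn k)); lia.
    exists (Ordinal lt_q) => //; apply/val_inj.
    by rewrite /= inordK // -e -divn_eq.
  by rewrite inordK // modnMDl modn_small.
rewrite card_imset ?card_ord // => p q /(congr1 (fun y => val y %/ m)%N) /=.
rewrite !inordK // !divnMDl // divn_small // !addn0; exact: val_inj.
Qed.

(** Faces are coded by their vertex sums, which must hit the maximum [r * m] and every nonzero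
    residue modulo [m]. *)
Lemma esd_fcount_hitting F :
  esd_fcount n r F m
  = #|hitting ord0 F setT ([set ord_max : Y] :: [seq residue_block c | c <- iota 1 k])|.
Proof.
set W := hitting _ _ _ _.
pose Phi (G : {set esd_vertex n r}) : {ffun 'I_n -> Y} := [ffun i => inord (face_sum G i)].
have WP (w : {ffun 'I_n -> Y}) : reflect (face_weight r k F (fun i => w i)) (w \in W).
  rewrite inE /=; apply: (iffP and3P).
    case=> /mem_pffun_on[wF _] /existsP[i0 wi0] /allP wres.
    split=> [i /wF->//|i||c cm]; first by rewrite -ltnS ltn_ord.
      by exists i0; move: wi0; rewrite inE => /eqP->.
    have /wres/existsP[i] : residue_block c \in [seq residue_block c | c <- iota 1 k].
      by apply: map_f; rewrite mem_iota add1n.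
    by rewrite inE => /eqP; exists i.
  case=> wF wle [i0 wi0] wres; split.
  - apply/mem_pffun_on; split=> [i iF|i _]; last by rewrite inE.
    by apply: val_inj; exact: wF.
  - by apply/existsP; exists i0; rewrite inE -val_eqE /= wi0.
  apply/allP => B /mapP[c]; rewrite mem_iota add1n => /wres[i e] ->.
  by apply/existsP; exists i; rewrite inE e.
have PhiE G i : esd_face_in F G -> #|G| = m -> (Phi G i : nat) = face_sum G i.
  move=> Gf Gm; have [_ h _ _] := face_sum_weight r0 Gf Gm.
  by rewrite ffunE inordK // ltnS h.
rewrite /esd_fcount; set Fs := [set G | _].
have -> : W = Phi @: Fs.
  apply/setP => w; apply/WP/imsetP => [/(weight_face_sum r0)[G [Gf Gm GE]]|[G]].
    exists G; first by rewrite inE Gf Gm eqxx.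
    by apply/ffunP => i; apply/val_inj; rewrite /= PhiE // GE.
  rewrite inE => /andP[Gf /eqP Gm] ->.
  have [gF gle [i0 gi0] gres] := face_sum_weight r0 Gf Gm.
  split=> [i /gF|i||c /gres[i e]]; rewrite ?PhiE //; first by exists i0; rewrite PhiE.
  by exists i; rewrite PhiE.
rewrite card_in_imset // => G G'; rewrite !inE => /andP[Gf /eqP Gm] /andP[G'f /eqP G'm] e.
apply: (face_sum_inj (k := k)) => //; try by [case/andP: Gf|case/andP: G'f].
by move=> i; rewrite -!PhiE // e.
Qed.

Lemma residue_blocks_disjoint :
  pairwise (fun A B : {set Y} => [disjoint A & B]) [seq residue_block c | c <- iota 1 k].
Proof.
have := iota_uniq 1 k; rewrite uniq_pairwise pairwise_map; apply: sub_pairwise => c d /= cd.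
apply/pred0P => y /=; rewrite !inE; apply: contraNF cd.
by case/andP=> /eqP<- /eqP<-.
Qed.

Lemma esd_fcountS (R : comNzRingType) F :
  (esd_fcount n r F m)%:R
  = (fdiff r%:R k #|F|).[r.+1%:R] - (fdiff r%:R k #|F|).[r%:R] :> R.
Proof.
pose Bs := [seq residue_block c | c <- iota 1 k].
have sBs : size Bs = k by rewrite size_map size_iota.
have BsP B : B \in Bs -> [/\ #|B| = r, ord0 \notin B & ord_max \notin B].
  case/mapP=> c; rewrite mem_iota add1n => ck ->; have /andP[c0 _] := ck.
  by rewrite card_residue_block // !inE /= mod0n modnMl; split=> //; rewrite eq_sym -lt0n.
(* The block containing only [r * m] has size 1, not [r], so it is split off by hand. Outside the
   residue blocks lie [r + 1] values, or [r] without the maximum. *)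
have max_neq0 : (ord0 : Y) \notin [set ord_max].
  by rewrite inE -val_eqE /= eq_sym -lt0n muln_gt0 r0.
have := card_hitting_cons F setT Bs max_neq0 => /(congr1 (fun a => a%:R : R)).
rewrite -esd_fcount_hitting natrD.
rewrite (@card_hitting _ _ _ _ R r Bs (_ :\ _) r) ?sBs; first last.
- by rewrite setTD cardsC1 card_ord /m mulnS.
- by move=> B /BsP[? ? ?]; split=> //; rewrite subsetD subsetT disjoint_sym disjoints1.
- exact: residue_blocks_disjoint.
rewrite (@card_hitting _ _ _ _ R r Bs setT r.+1) ?sBs; first last.
- by rewrite cardsT card_ord /m mulnS; lia.
- by move=> B /BsP[? ? ?]; split=> //; apply: subsetT.
- exact: residue_blocks_disjoint.
by move<-; rewrite addrK.
Qed.

End FaceCount.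

Lemma esd_fcount0 n r (F : {set 'I_n}) : esd_fcount n r F 0 = 1%N.
Proof.
rewrite /esd_fcount (_ : [set _ | _] = [set set0]) ?cards1 //.
apply/setP => G; rewrite !inE cards_eq0 andbC; case: eqP => //= ->.
by apply/andP; split; apply/forall_inP => x; rewrite inE.
Qed.

(** * The local h-polynomial *)

(** The right-hand side is expressed through [geom_fdiff] at [t = 1] and [t = r]. Shifting 1 to
    [1 + r] leaves increments from [r] to [r + 1], which are the face numbers. *)
Lemma horner_esd_h n r (F : {set 'I_n}) (z : algC) : (0 < r)%N -> z != 1 ->
  (1 - z) * (esd_h n r F).[z]
  = r%:R ^+ #|F| * ((exc_fix z #|F|).[z + (1 - z) / r%:R] - z * (exc_fix z #|F|).[1]).
Proof.
move=> r0 z1; have z1' : 1 - z != 0 by rewrite subr_eq0 eq_sym.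
have rn0 : r%:R != 0 :> algC by rewrite pnatr_eq0 -lt0n.
rewrite /esd_h; set m := #|F|.
have gE (t : algC) : (1 - z) ^+ m * (geom_fdiff z r%:R m).[t]
   = r%:R ^+ m * (exc_fix z m).[z + (1 - z) / r%:R * t].
  rewrite -[LHS]hornerZ geom_fdiffE // hornerZ horner_comp; congr (_ * _.[_]).
  by rewrite !hornerE.
have -> : (exc_fix z m).[1] = (exc_fix z m).[z + (1 - z) / r%:R * r%:R].
  by rewrite divfK // addrC subrK.
have -> : (exc_fix z m).[z + (1 - z) / r%:R] = (exc_fix z m).[z + (1 - z) / r%:R * 1].
  by rewrite mulr1.
rewrite mulrBr [r%:R ^+ m * (z * _)]mulrCA -!gE (geom_fdiff_shift _ 1) // expr1n mulr1.
(* The empty face matches the term left over by the shift. *)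
rewrite horner_sum big_ord_recl /= esd_fcount0 expr0 mul1r subn0 scale1r.
set G := geom_fdiff z r%:R m.
have -> : (1 - z) ^+ m * (z * G.[1 + r%:R] + (1 - z)) - z * ((1 - z) ^+ m * G.[r%:R])
  = (1 - z) * (1 - z) ^+ m + (1 - z) ^+ m * (z * (G.[1 + r%:R] - G.[r%:R])) by ring.
have XE : (1 - 'X : {poly algC}).[z] = 1 - z by rewrite !hornerE.
rewrite mulrDr; congr (_ + _); first by rewrite horner_exp XE.
(* The difference of order [m] is constant, so the last increment drops out. *)
rewrite !horner_sum -sumrB [in RHS]big_ord_recr /= !hornerZ (fdiff_const _ _ r%:R) subrr addr0.
rewrite !mulr_sumr; apply: eq_bigr => k _.
rewrite /bump /= add1n !hornerZ hornerM hornerXn horner_exp XE.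
rewrite esd_fcountS // -mulrBr -[r.+1]add1n natrD expr_div_n -/m.
have -> : (1 - z) ^+ m = (1 - z) ^+ (m - k.+1) * (1 - z) ^+ k.+1.
  by rewrite -exprD subnK.
by rewrite !exprS; field; rewrite expf_neq0.
Qed.

Lemma sum_by_card (V : nmodType) n (f : nat -> V) :
  \sum_(F : {set 'I_n}) f #|F| = \sum_(k < n.+1) f k *+ 'C(n, k).
Proof.
rewrite (partition_big (fun F : {set 'I_n} => inord #|F| : 'I_n.+1) predT) //=.
apply: eq_bigr => k _.
rewrite (eq_bigr (fun=> f k)) => [|F /eqP <-]; last first.
  by rewrite inordK // ltnS -[X in (_ <= X)%N](card_ord n) max_card.
rewrite sumr_const; congr (_ *+ _).
have := card_draws 'I_n k; rewrite card_ord => <-; apply: eq_card => F.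
rewrite -[LHS]/(inord #|F| == k :> 'I_n.+1) inE -val_eqE /= inordK //.
by rewrite ltnS -[X in (_ <= X)%N](card_ord n) max_card.
Qed.

Lemma esd_local_hE n r : (0 < r)%N ->
  (1 - 'X) * esd_local_h n r
  = derangement_poly algC r n - 'X * derangement_poly_rev algC r n.
Proof.
move=> r0; have rn0 : r%:R != 0 :> algC by rewrite pnatr_eq0 -lt0n.
apply: poly_eq_horner_neq1 => z z1.
rewrite hornerD hornerN !hornerM hornerX horner_derangement_poly //.
rewrite horner_derangement_poly_rev // hornerD hornerN hornerX hornerC horner_sum.
pose f m := (-1) ^+ (n - m) * (r%:R ^+ m *
  ((exc_fix z m).[z + (1 - z) / r%:R] - z * (exc_fix z m).[1])).
rewrite mulr_sumr (eq_bigr (fun F : {set 'I_n} => f #|F|)) => [|F _]; last first.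
  rewrite hornerM mulrCA horner_esd_h // /f; congr (_ * _).
  by rewrite -polyC1 -polyCN -polyC_exp hornerC.
rewrite sum_by_card.
(* The alternating sum over subsets is the Taylor expansion of a shift by [- r%:R^-1]. *)
have shift x : r%:R ^+ n * (exc_fix z n).[x - r%:R^-1]
    = \sum_(k < n.+1) ((-1) ^+ (n - k) * (r%:R ^+ k * (exc_fix z k).[x])) *+ 'C(n, k).
  rewrite exc_fix_taylor mulr_sumr (reindex_inj rev_ord_inj) /=.
  apply: eq_bigr => k _; rewrite subSS.
  have kn : (k <= n)%N by rewrite -ltnS.
  rewrite subKn // bin_sub // -[RHS]mulr_natr.
  have -> : (- r%:R^-1) ^+ (n - k) = (-1) ^+ (n - k) / r%:R ^+ (n - k) :> algC.
    by rewrite [LHS]exprNn exprVn.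
  have -> : r%:R ^+ n = r%:R ^+ (n - k) * r%:R ^+ k :> algC by rewrite -exprD subnK.
  by field; rewrite expf_neq0.
have -> : z * (r.-1%:R / r%:R) = z + (1 - z) / r%:R - r%:R^-1.
  by rewrite -subn1 natrB //; field.
have -> : r.-1%:R / r%:R = 1 - r%:R^-1 :> algC.
  by rewrite -subn1 natrB //; field.
rewrite !shift mulr_sumr -sumrB; apply: eq_bigr => k _.
by rewrite mulrnAr -mulrnBl /f; congr (_ *+ _); ring.
Qed.

(** Reversing [a + 'X * b] in degree [n] fixes [a] and turns ['X * b] into [b], by the two
    symmetries. *)
Lemma In_decomposition_rev n r (a b : {poly algC}) :
  In_decomposition n (colored_derangement_poly n r) a b ->
  derangement_poly algC r n = a + 'X * b /\ derangement_poly_rev algC r n = a + b.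
Proof.
rewrite colored_derangement_polyE => -[dE sa sb aE bE]; split=> //.
apply/polyP => i; have [ni|i_n] := ltnP n i.
  rewrite coefD [a`_i]nth_default ?[b`_i]nth_default ?addr0; first last.
  - exact: leq_trans sa ni.
  - exact: leq_trans sb (ltnW ni).
  rewrite coef_derangement_poly_rev big_pred0 // => s.
  apply: contraTF ni => /eqP<-; rewrite -leqNgt (leq_trans _ (nb_wexc_le s)) //.
  by rewrite nb_wexcE leq_addr.
rewrite derangement_polyK // /derangement_poly dE !coefD coefXM.
rewrite [in RHS]aE coef_poly ltnS i_n; congr (_ + _).
have [lt_in|ge_in] := ltnP i n; last first.
  by rewrite subn_eq0 ge_in nth_default // (leq_trans sb).
by rewrite subn_eq0 leqNgt lt_in [in RHS]bE coef_poly lt_in /=; congr b`_ _; lia.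
Qed.

Unset Implicit Arguments.

Theorem theorem5p1 (n r : nat) : (0 < n)%N -> (0 < r)%N ->
  (forall a b : {poly algC},
     In_decomposition n (colored_derangement_poly n r) a b ->
     real_rooted a /\ real_rooted b)
  /\ real_rooted (esd_local_h n r).
Proof.
move=> n0 r0; split=> [a b /In_decomposition_rev[dE eE]|].
  split.
    by apply: derangement_combination_real_rooted n0 r0 _; rewrite dE eE; ring.
  by apply: derangement_diff_real_rooted n0 r0 _; rewrite dE eE; ring.
exact: derangement_combination_real_rooted n0 r0 (esd_local_hE n r0).
Qed.
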